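(* Let $n\ge4$. For $i\in\{1,2\}$, $\alpha>0$ and $c_i,c_3\in\mathbb{R}$ consider the problem $$(\mathrm{P}_i)\qquad \Delta^2U=\kappa U^{p^*}\ \text{ in }\mathbb{B}^{n+1},\qquad U=\alpha,\quad \mathcal{B}_i(U)=c_i\alpha^{p_i^*},\quad \mathcal{B}_3(U)=c_3\alpha^{p_3^*}\ \text{ on }\mathbb{S}^n .$$ (1) Let $i=1$ and $c_1\le0$. If $$0<\alpha<\Big(1+\frac{4c_1^2}{(n-3)^2}\Big)^{-\frac{n-3}4},$$ then there exist a positive smooth radial function $U_\alpha\in C^\infty(\overline{\mathbb{B}^{n+1}})$ and a constant $c_3\in\mathbb{R}$ such that $U_\alpha$ solves $(\mathrm{P}_1)$. Moreover, $c_3$ satisfies $$\frac{(n^2-1)(n-3)}4\alpha^{-\frac6{n-3}}L(\alpha,c_1)\le c_3\le\frac{(n^2-1)(n-3)}4\alpha^{-\frac6{n-3}},$$ where $$L(\alpha,c_1):=1-\alpha^{\frac8{n-3}}\Big(1-\frac{4c_1^2\alpha^{\frac4{n-3}}}{(n-3)^2}\Big)^{-2}\Big[1-\frac{c_1\alpha^{\frac2{n-3}}}{n-3}\Big(3-\frac{4c_1^2\alpha^{\frac4{n-3}}}{(n-3)^2}\Big)\Big].$$ (2) Let $i=2$ and $c_2\le0$. There exist $\alpha_0>0$ and a family $\{U_\alpha\}_{0<\alpha<\alpha_0}$ of positive smooth radial functions such that each $U_\alpha$ solves $(\mathrm{P}_2)$ with a corresponding constant $c_3=c_3(\alpha)$,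 and $$c_3(\alpha)=\frac{(n^2-1)(n-3)}4\alpha^{1-p_3^*}+O(\alpha^{p^*-p_3^*})\quad\text{as }\alpha\to0^+ .$$
   Context: Notation: $\mathbb{B}^{n+1}$ is the open unit ball of $\mathbb{R}^{n+1}$ with boundary $\mathbb{S}^n$; $p^*=\frac{n+5}{n-3}$, $p_k^*=\frac{n+2k-3}{n-3}$ for $k=1,2,3$; $\kappa=\frac{(n-3)(n-1)(n+1)(n+3)}{16}$. Conformal boundary operators on the unit ball, with $r=|\xi|$ (evaluated on $\mathbb{S}^n$): $\mathcal{B}_1(U)=\partial_rU+\frac{n-3}2U$; $\mathcal{B}_2(U)=\partial_r^2U-\Delta_{\mathbb{S}^n}U+(n-2)\partial_rU+\frac{(n-3)(n-1)}2U$; $\mathcal{B}_3(U)=-\partial_r\Delta U-2\Delta_{\mathbb{S}^n}\partial_rU-\frac{n-3}2\partial_r^2U-\frac{3n-5}2\Delta_{\mathbb{S}^n}U+\frac{n-3}2\partial_rU+\frac{(n^2-1)(n-3)}4U$. *)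

(* Defs.v *)
From HB Require Import structures.
From mathcomp Require Import all_boot all_order all_algebra.
From mathcomp Require Import all_classical all_reals all_analysis.

Set Implicit Arguments.
Unset Strict Implicit.
Unset Printing Implicit Defensive.

Import Order.TTheory GRing.Theory Num.Theory.
Import numFieldNormedType.Exports.

Local Open Scope classical_set_scope.
Local Open Scope ring_scope.

(* The library norm on 'rV[R]_m is the sup norm, hence a separate Euclidean
   norm; both induce the same topology, so that open sets, continuity and
   directional derivatives are the library's. *)
Definition enorm (R : realType) (m : nat) (x : 'rV[R]_m) : R :=
  Num.sqrt (\sum_(i < m) x 0 i ^+ 2).

Definition unit_ball (R : realType) (m : nat) : set 'rV[R]_m :=
  [set x | enorm x < 1].

Definition closed_unit_ball (R : realType) (m : nat) : set 'rV[R]_m :=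
  [set x | enorm x <= 1].

Definition unit_sphere (R : realType) (m : nat) : set 'rV[R]_m :=
  [set x | enorm x = 1].

Definition partial (R : realType) (m : nat) (i : 'I_m.+1)
    (U : 'rV[R]_m.+1 -> R) : 'rV[R]_m.+1 -> R :=
  fun x => 'D_(delta_mx 0 i) U x.

Definition partials (R : realType) (m : nat) (s : seq 'I_m.+1)
    (U : 'rV[R]_m.+1 -> R) : 'rV[R]_m.+1 -> R :=
  foldr (@partial R m) U s.

Definition smooth_on (R : realType) (m : nat) (O : set 'rV[R]_m.+1)
    (U : 'rV[R]_m.+1 -> R) : Prop :=
  forall (s : seq 'I_m.+1) (x : 'rV[R]_m.+1), O x ->
    {for x, continuous (partials s U)} /\
    forall i : 'I_m.+1, derivable (partials s U) x (delta_mx 0 i).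

(* Membership in C^oo of the closed unit ball. Functions are total: the values
   of U near the closed ball are those of a smooth extension, and all
   derivatives at boundary points are determined by U on the ball. *)
Definition smooth_closed_ball (R : realType) (m : nat)
    (U : 'rV[R]_m.+1 -> R) : Prop :=
  exists O : set 'rV[R]_m.+1,
    [/\ open O, @closed_unit_ball R m.+1 `<=` O & smooth_on O U].

Definition radial (R : realType) (m : nat) (U : 'rV[R]_m.+1 -> R) : Prop :=
  forall x y : 'rV[R]_m.+1, closed_unit_ball x -> closed_unit_ball y ->
    enorm x = enorm y -> U x = U y.

Definition positive_smooth_radial (R : realType) (m : nat)
    (U : 'rV[R]_m.+1 -> R) : Prop :=
  [/\ forall x, closed_unit_ball x -> 0 < U x,
      smooth_closed_ball U & radial U].

Definition laplacian (R : realType) (m : nat) (U : 'rV[R]_m.+1 -> R) :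
    'rV[R]_m.+1 -> R :=
  fun x => \sum_(i < m.+1) partial i (partial i U) x.

(* Only meaningful away from the origin. *)
Definition radial_derivative (R : realType) (m : nat)
    (U : 'rV[R]_m.+1 -> R) : 'rV[R]_m.+1 -> R :=
  fun x => 'D_((enorm x)^-1 *: x) U x.

(* Laplace-Beltrami operator of the unit sphere applied to the restriction of
   U, as the Euclidean Laplacian of the extension of that restriction which is
   constant along rays; only meaningful at points of the sphere. *)
Definition sphere_laplacian (R : realType) (m : nat)
    (U : 'rV[R]_m.+1 -> R) : 'rV[R]_m.+1 -> R :=
  laplacian (fun y => U ((enorm y)^-1 *: y)).

Definition B1 (R : realType) (n : nat) (U : 'rV[R]_n.+1 -> R)
    (x : 'rV[R]_n.+1) : R :=
  radial_derivative U x + (n%:R - 3) / 2 * U x.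

Definition B2 (R : realType) (n : nat) (U : 'rV[R]_n.+1 -> R)
    (x : 'rV[R]_n.+1) : R :=
  radial_derivative (radial_derivative U) x - sphere_laplacian U x
  + (n%:R - 2) * radial_derivative U x
  + (n%:R - 3) * (n%:R - 1) / 2 * U x.

Definition B3 (R : realType) (n : nat) (U : 'rV[R]_n.+1 -> R)
    (x : 'rV[R]_n.+1) : R :=
  - radial_derivative (laplacian U) x
  - 2 * sphere_laplacian (radial_derivative U) x
  - (n%:R - 3) / 2 * radial_derivative (radial_derivative U) x
  - (3 * n%:R - 5) / 2 * sphere_laplacian U x
  + (n%:R - 3) / 2 * radial_derivative U x
  + (n%:R ^+ 2 - 1) * (n%:R - 3) / 4 * U x.

Definition pstar (R : realType) (n : nat) : R := (n%:R + 5) / (n%:R - 3).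

Definition pstar_bd (R : realType) (n k : nat) : R :=
  (n%:R + 2 * k%:R - 3) / (n%:R - 3).

Definition kappa (R : realType) (n : nat) : R :=
  (n%:R - 3) * (n%:R - 1) * (n%:R + 1) * (n%:R + 3) / 16.

(* The boundary operator of index i in {1, 2, 3}; other indices are not used. *)
Definition conformal_B (R : realType) (n i : nat) (U : 'rV[R]_n.+1 -> R) :
    'rV[R]_n.+1 -> R :=
  match i with
  | 1%N => B1 U
  | 2%N => B2 U
  | _ => B3 U
  end.

Definition solves_P (R : realType) (n i : nat) (alpha ci c3 : R)
    (U : 'rV[R]_n.+1 -> R) : Prop :=
  (forall x, unit_ball x ->
     laplacian (laplacian U) x = kappa R n * U x `^ pstar R n) /\
  (forall x, unit_sphere x ->
     [/\ U x = alpha,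
         conformal_B i U x = ci * alpha `^ pstar_bd R n i &
         conformal_B 3 U x = c3 * alpha `^ pstar_bd R n 3]).

Definition Lbound (R : realType) (n : nat) (alpha c1 : R) : R :=
  let q := 4 * c1 ^+ 2 * alpha `^ (4 / (n%:R - 3)) / (n%:R - 3) ^+ 2 in
  1 - alpha `^ (8 / (n%:R - 3)) * (1 - q) ^- 2 *
      (1 - c1 * alpha `^ (2 / (n%:R - 3)) / (n%:R - 3) * (3 - q)).

(* Main.v *)
Require Import Defs.
From HB Require Import structures.
From mathcomp Require Import all_boot all_order all_algebra.
From mathcomp Require Import all_classical all_reals all_analysis.
From mathcomp Require Import ring lra.

Set Implicit Arguments.
Unset Strict Implicit.
Unset Printing Implicit Defensive.

Import Order.TTheory GRing.Theory Num.Theory.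
Import numFieldNormedType.Exports.

Local Open Scope classical_set_scope.
Local Open Scope ring_scope.

(* In the variable s = |x|^2 the Laplacian of a radial function f(|x|^2) is
   4 (s f'' + m f') with m = (n + 1) / 2, and the bounded solution of
   s y' + m y = g is the average y(s) = 2 int_0^1 t^n g(t^2 s) dt. Hence the
   radial Dirichlet problem for Delta^2 has an explicit solution operator,
   monotone in the source because averages and primitives of nonnegative
   functions are nondecreasing; no Green function of the ball is needed.
   Prescribing B_2 instead of B_1 only makes the slope at the boundary an
   increasing function of the source. Solutions below a supersolution come from
   Tarski's fixed point argument in a class of Lipschitz functions: for (P_1) the
   supersolution is the standard bubble with the same Cauchy data on the sphere,
   for (P_2) it is a small constant. The value of B_3 is a constant minus a
   monotone linear functional of the source, which the supersolution bounds; for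
   the bubble this functional is explicit and gives L(alpha, c_1). *)

(** * Averages and primitives of continuous functions *)

(** Smoothness up to the boundary asks for a solution on a neighbourhood of the closed ball, and
    f(|x|^2) is smooth at the origin once f is smooth across s = 0. The profile is therefore built
    on some [-d, 1 + d], although the data sit at s = 1 and the supersolution is compared on [0, 1]
    only; hence the split into a problem on [0, 1] and an extension. The data f(1) = alpha, f'(1) =
    -B give an integral equation f = alpha + B (1 - s) + z with z >= 0 and z(1) = z'(1) = 0. B_3 is
    monotone in the source because f'(1) cancels in it: only f(1), f''(1) and the derivative at 1 of
    s f'' + m f' survive. The bubble in (P_1) has its amplitude and scale fixed by alpha and c_1, so
    its bilaplacian is its own source divided by some theta; the bound on alpha is what gives theta
    <= 1. In (P_2) the slope B depends on the unknown through f''(1). There p^* > 1 makes the source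
    of a constant of order alpha small against alpha, which gives both the supersolution and the
    error term. *)

(* Sealed: unfolding the Lebesgue integral makes conversion checks diverge. *)
HB.lock Definition int01 {R : realType} (h : R -> R) : R :=
  \int[@lebesgue_measure R]_(t in `[0, 1]) h t.

Section integral01.
Context {R : realType}.
Implicit Types (h k : R -> R).
Local Notation mu := (@lebesgue_measure R).

Definition continuous01 (h : R -> R) := {within `[0, 1], continuous h}.

Lemma integrable01 h : continuous01 h -> mu.-integrable `[0, 1] (EFin \o h).
Proof.
by move=> ch; apply: continuous_compact_integrable => //; exact: segment_compact.
Qed.

Lemma int01D h k : continuous01 h -> continuous01 k ->
  int01 (fun t => h t + k t) = int01 h + int01 k.
Proof.
move=> /integrable01 ih /integrable01 ik.
by rewrite int01.unlock; exact: RintegralD.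
Qed.

Lemma int01Z (c : R) h : continuous01 h -> int01 (fun t => c * h t) = c * int01 h.
Proof. by move=> /integrable01 ih; rewrite int01.unlock; exact: RintegralZl. Qed.

Lemma eq_int01 h k : (forall t, 0 <= t <= 1 -> h t = k t) -> int01 h = int01 k.
Proof.
by move=> hk; rewrite int01.unlock; apply: eq_Rintegral => t; rewrite inE/= in_itv/= => /hk.
Qed.

Lemma int01_ge0 h : (forall t, 0 <= t <= 1 -> 0 <= h t) -> 0 <= int01 h.
Proof.
move=> h0; rewrite int01.unlock; apply: Rintegral_ge0 => t/=.
by rewrite in_itv/= => /h0.
Qed.

Lemma int01_FTC (H h : R -> R) : continuous01 h ->
  (forall t : R, 0 <= t <= 1 -> is_derive t 1 H (h t)) -> int01 h = H 1 - H 0.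
Proof.
move=> ch dH.
have cH t : 0 <= t <= 1 -> {for t, continuous H}.
  by move=> /dH[+ _] => /derivable1_diffP/differentiable_continuous.
rewrite int01.unlock /Rintegral (@continuous_FTC2 _ h H)//.
- split.
  + by move=> t; rewrite in_itv/= => /andP[t0 t1]; have [] := dH t; rewrite ?ltW.
  + by apply: cvg_at_right_filter; apply: cH; rewrite lexx ler01.
  + by apply: cvg_at_left_filter; apply: cH; rewrite lexx ler01.
- move=> t; rewrite in_itv/= => /andP[t0 t1].
  by rewrite derive1E; have [_ ->] := dH t (introT andP (conj (ltW t0) (ltW t1))).
Qed.

Lemma continuous01W h : (forall t : R, 0 <= t <= 1 -> {for t, continuous h}) ->
  continuous01 h.
Proof.
move=> ch; apply: continuous_in_subspaceT => t; rewrite inE/= in_itv/=; exact: ch.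
Qed.

End integral01.

Lemma is_derive_continuous {R : realType} (f : R -> R) (x df : R) :
  is_derive x 1 f df -> {for x, continuous f}.
Proof. by move=> [+ _] => /derivable1_diffP/differentiable_continuous. Qed.

Lemma is_derive_cast {R : realType} (f g : R -> R) (x d e : R) :
  is_derive x 1 f d -> f =1 g -> d = e -> is_derive x 1 g e.
Proof. by move=> + /funext <- <-. Qed.

Section is_derive_real.
Context {R : realType}.
Implicit Types (f g : R -> R) (x c : R).

Lemma is_derive_addf f g x a b : is_derive x 1 f a -> is_derive x 1 g b ->
  is_derive x 1 (fun y => f y + g y) (a + b).
Proof. by move=> df dg; exact: (is_deriveD df dg). Qed.

Lemma is_derive_subf f g x a b : is_derive x 1 f a -> is_derive x 1 g b ->
  is_derive x 1 (fun y => f y - g y) (a - b).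
Proof. by move=> df dg; exact: (is_deriveB df dg). Qed.

Lemma is_derive_scalef c f x a : is_derive x 1 f a ->
  is_derive x 1 (fun y => c * f y) (c * a).
Proof. by move=> df; exact: (is_deriveZ c df). Qed.

Lemma is_derive_mulf f g x a b : is_derive x 1 f a -> is_derive x 1 g b ->
  is_derive x 1 (fun y => f y * g y) (f x * b + g x * a).
Proof. by move=> df dg; exact: (is_deriveM df dg). Qed.

Lemma is_derive_mull c x : is_derive x 1 (fun y : R => c * y) c.
Proof.
by apply: (is_derive_cast (is_derive_scalef c (is_derive_id x 1))); rewrite ?mulr1.
Qed.

Lemma is_derive_mulr c x : is_derive x 1 (fun y : R => y * c) c.
Proof. by apply: (is_derive_cast (is_derive_mull c x)) => // y; rewrite mulrC. Qed.

Lemma is_derive_expf n x : is_derive x 1 (fun y : R => y ^+ n) (n%:R * x ^+ n.-1).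
Proof.
apply: (is_derive_cast (is_deriveX n (is_derive_id x 1))) => [y|].
  by rewrite fctE.
by rewrite [LHS]mulr1.
Qed.

Lemma is_derive_compf f g x a b : is_derive (g x) 1 f a -> is_derive x 1 g b ->
  is_derive x 1 (fun y => f (g y)) (a * b).
Proof.
by move=> df dg; apply: (is_derive_cast (is_derive1_comp df dg)) => //.
Qed.

End is_derive_real.

Section average.
Context {R : realType}.
Implicit Types (g : R -> R) (j : nat) (s t u v : R).
Local Notation mu := (@lebesgue_measure R).

(* For j = n, the bounded solution y of s y' + (n + 1) / 2 y = g. *)
Definition Jop j g s : R := 2 * int01 (fun t => t ^+ j * g (t ^+ 2 * s)).

Lemma shrink_oo u v s t : u < 0 -> 0 < v -> s \in `]u, v[ -> 0 <= t <= 1 ->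
  t ^+ 2 * s \in `]u, v[.
Proof.
rewrite !in_itv/= => u0 v0 /andP[us sv] /andP[t0 t1].
have t21 : t ^+ 2 <= 1 by rewrite expr_le1.
have t20 : 0 <= t ^+ 2 by rewrite exprn_ge0.
by have [s0|s0] := leP 0 s; apply/andP; split; nra.
Qed.

Lemma shrink_cc u v s t : u <= 0 -> 0 <= v -> u <= s <= v -> 0 <= t <= 1 ->
  u <= t ^+ 2 * s <= v.
Proof.
move=> u0 v0 /andP[us sv] /andP[t0 t1].
have t21 : t ^+ 2 <= 1 by rewrite expr_le1.
have t20 : 0 <= t ^+ 2 by rewrite exprn_ge0.
by have [s0|s0] := leP 0 s; apply/andP; split; nra.
Qed.

Lemma continuous_comp_sqr g s t : {for t ^+ 2 * s, continuous g} ->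
  {for t, continuous (fun t => g (t ^+ 2 * s))}.
Proof.
move=> cg; apply: (@continuous_comp _ _ _ (fun t : R => t ^+ 2 * s) g) => //.
by apply: continuousM; [exact: exprn_continuous|exact: cst_continuous].
Qed.

Lemma Jop_integrand g u v j s : u < 0 -> 0 < v ->
  {in `]u, v[, forall x, {for x, continuous g}} -> s \in `]u, v[ ->
  continuous01 (fun t => t ^+ j * g (t ^+ 2 * s)).
Proof.
move=> u0 v0 cg sI; apply: continuous01W => t t01.
apply: continuousM; first exact: exprn_continuous.
by apply: continuous_comp_sqr; apply: cg; exact: shrink_oo.
Qed.

Lemma locally_bounded g u v s : u < 0 -> 0 < v ->
  {in `]u, v[, forall x, {for x, continuous g}} -> s \in `]u, v[ ->
  exists a b M : R, [/\ u < a, a < 0, 0 < b & b < v] /\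
    [/\ s \in `]a, b[, 0 <= M & {in `]a, b[, forall x, `|g x| <= M}].
Proof.
move=> u0 v0 cg; rewrite in_itv/= => /andP[us sv].
(* The interval must contain 0 as well as [s]: it is then stable under [x |-> t ^+ 2 * x], so one
   bound [M] dominates the integrand for all [t] in [0, 1]. *)
pose a := (u + Num.min s 0) / 2; pose b := (v + Num.max s 0) / 2.
have [ua a0 as_] : [/\ u < a, a < 0 & a < s].
  by rewrite /a /Num.min; case: ifPn; rewrite -?leNgt => ?; split; lra.
have [bv b0 sb] : [/\ b < v, 0 < b & s < b].
  by rewrite /b /Num.max; case: ifPn; rewrite -?leNgt => ?; split; lra.
have ab : a <= b by rewrite ltW// (lt_trans a0).
have cng : {within `[a, b], continuous (fun x => `|g x|)}.
  apply: continuous_in_subspaceT => x; rewrite inE/= in_itv/= => /andP[ax xb].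
  apply: (@continuous_comp _ _ _ g (fun y => `|y|)); last exact: norm_continuous.
  by apply: cg; rewrite in_itv/= (lt_le_trans ua)//= (le_lt_trans xb).
have [c _ cM] := EVT_max ab cng.
exists a, b, `|g c|; split; split => //; first by rewrite in_itv/= as_ sb.
by move=> x /subset_itv_oo_cc; exact: cM.
Qed.

Lemma Jop_continuous g u v j : u < 0 -> 0 < v ->
  {in `]u, v[, forall x, {for x, continuous g}} ->
  {in `]u, v[, forall x, {for x, continuous (Jop j g)}}.
Proof.
move=> u0 v0 cg s sI.
have [a [b [M [[ua a0 b0 bv] [sab M0 gM]]]]] := locally_bounded u0 v0 cg sI.
have cg' : {in `]a, b[, forall x, {for x, continuous g}}.
  move=> x; rewrite in_itv/= => /andP[ax xb]; apply: cg.
  by rewrite in_itv/= (lt_trans ua)//= (lt_trans xb).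
apply: continuousM; first exact: cst_continuous.
have H := @continuity_under_integral R _ _ mu
  (fun x t => t ^+ j * g (t ^+ 2 * x)) `[0, 1] _ a b _ _ (fun=> M).
rewrite int01.unlock; apply: (H _ _ _ _ _ s); rewrite ?inE//.
- by move=> x xab; apply: integrable01; exact: Jop_integrand cg' _.
- apply: aeW => t; rewrite /= in_itv/= => t01 x; rewrite inE/= => xab.
  suff : {for x, continuous (fun x : R => t ^+ j * g (t ^+ 2 * x))} by [].
  apply: continuousM; first exact: cst_continuous.
  apply: (@continuous_comp _ _ _ (fun x : R => t ^+ 2 * x) g).
    by apply: continuousM; [exact: cst_continuous|].
  by apply: cg'; exact: shrink_oo.
- by apply: integrable01; apply: continuous01W => t _; exact: cst_continuous.
- move=> x xab; apply: aeW => t; rewrite /= in_itv/= => t01.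
  have /andP[t0 t1] := t01.
  rewrite normrM (le_trans _ (gM _ (shrink_oo a0 b0 xab t01)))//.
  rewrite ler_piMl// ger0_norm ?exprn_ge0//.
  exact: exprn_ile1.
Qed.

(** Differentiating g(t^2 s) in s brings out a factor t^2, hence the index [j.+2]. The operators
    [Jop j], taken over all j, are thus closed under differentiation, which is why the exponent is
    kept as a parameter. *)
Lemma Jop_is_derive g g' u v j : u < 0 -> 0 < v ->
  {in `]u, v[, forall x : R, is_derive x 1 g (g' x)} ->
  {in `]u, v[, forall x, {for x, continuous g'}} ->
  {in `]u, v[, forall x : R, is_derive x 1 (Jop j g) (Jop j.+2 g' x)}.
Proof.
move=> u0 v0 dg cg' s sI.
have [a [b [M [[ua a0 b0 bv] [sab M0 gM]]]]] := locally_bounded u0 v0 cg' sI.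
have subab x : x \in `]a, b[ -> x \in `]u, v[.
  rewrite !in_itv/= => /andP[ax xb].
  by rewrite (lt_trans ua)//= (lt_trans xb).
have cg : {in `]a, b[, forall x, {for x, continuous g}}.
  by move=> x /subab/dg; exact: is_derive_continuous.
have dgt x t : x \in `]a, b[ -> 0 <= t <= 1 ->
    is_derive x 1 (fun x => t ^+ j * g (t ^+ 2 * x))
      (t ^+ j.+2 * g' (t ^+ 2 * x)).
  move=> xab t01.
  have /subab/dg d2 := shrink_oo a0 b0 xab t01.
  apply: (is_derive_cast (is_derive_scalef (t ^+ j)
    (is_derive_compf d2 (is_derive_mull (t ^+ 2) x)))) => //.
  by rewrite mulrCA -exprD addn2 mulrC.
have d1E x t : x \in `]a, b[ -> 0 <= t <= 1 ->
    partial1of2 (fun x t => t ^+ j * g (t ^+ 2 * x)) x t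
      = t ^+ j.+2 * g' (t ^+ 2 * x).
  by move=> xab t01; rewrite partial1of2E; have [_ ->] := dgt x t xab t01.
have intf x : x \in `]a, b[ -> mu.-integrable `[0, 1]
    (EFin \o (fun t => t ^+ j * g (t ^+ 2 * x))).
  by move=> xab; apply: integrable01; exact: Jop_integrand cg _.
have derf x t : `]a, b[%classic x -> `[0, 1]%classic t ->
    derivable (fun x => t ^+ j * g (t ^+ 2 * x)) x 1.
  by rewrite /= [in X in _ -> X -> _]in_itv/= => xab t01; have [] := dgt x t xab t01.
have intM : mu.-integrable `[0, 1] (EFin \o (fun _ : R => M)).
  by apply: integrable01; apply: continuous01W => t _; exact: cst_continuous.
have ubM x t : `]a, b[%classic x -> `[0, 1]%classic t ->
    `|partial1of2 (fun x t => t ^+ j * g (t ^+ 2 * x)) x t| <= M.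
  rewrite /= [in X in _ -> X -> _]in_itv/= => xab t01; rewrite d1E//.
  have /andP[t0 t1] := t01.
  rewrite normrM (le_trans _ (gM _ (shrink_oo a0 b0 xab t01)))//.
  rewrite ler_piMl// ger0_norm ?exprn_ge0//.
  exact: exprn_ile1.
have m01 : measurable (`[0%R, 1%R]%classic : set (measurableTypeR R)) by [].
have D1 := @derivable_under_integral R _ _ mu
  (fun x t => t ^+ j * g (t ^+ 2 * x)) `[0, 1] m01 s a b sab intf derf
  (fun=> M) (fun=> M0) intM ubM.
have D2 := @differentiation_under_integral R _ _ mu
  (fun x t => t ^+ j * g (t ^+ 2 * x)) `[0, 1] m01 s a b sab intf derf
  (fun=> M) (fun=> M0) intM ubM.
have D : is_derive s 1 (fun x => int01 (fun t => t ^+ j * g (t ^+ 2 * x)))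
    (int01 (fun t => t ^+ j.+2 * g' (t ^+ 2 * s))).
  have -> : int01 (fun t => t ^+ j.+2 * g' (t ^+ 2 * s)) = int01
      (fun t => partial1of2 (fun x t => t ^+ j * g (t ^+ 2 * x)) s t).
    by apply: eq_int01 => t t01; rewrite d1E.
  rewrite int01.unlock; apply: (DeriveDef D1).
  by rewrite -derive1E; exact: D2.
exact: is_derive_scalef.
Qed.

End average.

Lemma is_derive_ndecr {R : realType} (f df : R -> R) (u v : R) :
  (forall x : R, u <= x <= v -> is_derive x 1 f (df x)) ->
  (forall x : R, u <= x <= v -> 0 <= df x) ->
  forall s t : R, u <= s -> s <= t -> t <= v -> f s <= f t.
Proof.
move=> dfE df0 s t us st tv; rewrite -subr_ge0.
have sub x : x \in `[s, t] -> u <= x <= v.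
  by rewrite in_itv/= => /andP[sx xt]; rewrite (le_trans us)//= (le_trans xt).
have [c cst ->] := @MVT_segment R f df s t st
  (fun x xst => dfE x (sub x (subset_itv_oo_cc xst)))
  (derivable_within_continuous (fun x xst => ex_derive (is_derive := dfE x (sub x xst)))).
by rewrite mulr_ge0 ?subr_ge0// df0// sub.
Qed.

Lemma is_derive_lipschitz {R : realType} (f df : R -> R) (u v L : R) :
  (forall x : R, u <= x <= v -> is_derive x 1 f (df x)) ->
  (forall x : R, u <= x <= v -> `|df x| <= L) ->
  forall s t : R, u <= s <= v -> u <= t <= v -> `|f s - f t| <= L * `|s - t|.
Proof.
move=> dfE dfL.
suff H s t : u <= s <= v -> u <= t <= v -> s <= t -> `|f s - f t| <= L * `|s - t|.
  move=> s t us ut; have [|/ltW] := leP s t; first exact: H.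
  by rewrite distrC (distrC s); exact: H.
move=> /andP[us sv] /andP[ut tv] st.
have sub x : x \in `[s, t] -> u <= x <= v.
  by rewrite in_itv/= => /andP[sx xt]; rewrite (le_trans us)//= (le_trans xt).
have [c cst E] := @MVT_segment R f df s t st
  (fun x xst => dfE x (sub x (subset_itv_oo_cc xst)))
  (derivable_within_continuous (fun x xst => ex_derive (is_derive := dfE x (sub x xst)))).
by rewrite distrC E normrM (distrC s) ler_wpM2r// dfL// sub.
Qed.

(** * Primitives vanishing at 0 *)

Section primitive.
Context {R : realType}.
Implicit Types (y f : R -> R) (s t u v : R).
Local Notation mu := (@lebesgue_measure R).

(** Rescaling the integral to [0, 1] yields the primitive for both signs of [s] by one formula,
    without oriented integrals. *)
Definition prim y s : R := s * int01 (fun t => y (s * t)).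

Lemma prim_FTC f y u v s : u <= 0 <= v -> u <= s <= v ->
  (forall x : R, u <= x <= v -> is_derive x 1 f (y x)) ->
  (forall x : R, u <= x <= v -> {for x, continuous y}) ->
  prim y s = f s - f 0.
Proof.
move=> /andP[u0 v0] /andP[us sv] dfE cy.
have sub t : 0 <= t <= 1 -> u <= s * t <= v.
  by move=> /andP[t0 t1]; have [s0|s0] := leP 0 s; apply/andP; split; nra.
have cyt t : 0 <= t <= 1 -> {for t, continuous (fun t => y (s * t))}.
  move=> t01; apply: (@continuous_comp _ _ _ (fun t : R => s * t) y).
    by apply: continuousM; [exact: cst_continuous|].
  by apply: cy; exact: sub.
rewrite /prim -int01Z; last exact: continuous01W.
rewrite -[in RHS](mulr1 s) -(mulr0 s).
apply: (@int01_FTC _ (fun t => f (s * t))).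
  apply: continuous01W => t t01; apply: continuousM; first exact: cst_continuous.
  exact: cyt.
move=> t t01.
apply: (is_derive_cast (is_derive_compf (dfE _ (sub t t01)) (is_derive_mull s t))) => //.
by rewrite mulrC.
Qed.

Lemma prim_is_derive y s : continuous y -> is_derive s 1 (prim y) (y s).
Proof.
(* [F] starts to the left of both 0 and [s], so the fundamental theorem applies to it at every point
   near either; [prim y] is then recognised locally as [F - F 0]. *)
move=> cy; pose A := `|s| + 1; pose F x := \int[mu]_(t in `[(- A)%R, x]) y t.
have iy : mu.-integrable `[(- A)%R, (A + 1)%R] (EFin \o y).
  apply: continuous_compact_integrable; first exact: segment_compact.
  exact: continuous_subspaceT.
have A0 : 0 < A by rewrite ltr_wpDl.
have dF x : - A < x < A + 1 -> is_derive x 1 F (y x).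
  move=> /andP[Ax xA].
  have [dF FE] := continuous_FTC1_closed xA iy Ax (cy x).
  by apply: (DeriveDef dF); rewrite -derive1E FE.
have sA : `|s| < A by rewrite ltrDl.
have FE x : `|x| < A -> F x - F 0 = prim y x.
  rewrite ltr_norml => /andP[Ax xA].
  pose b := Num.min x 0; pose c := Num.max x 0.
  have [bA b0 bx] : [/\ - A < b, b <= 0 & b <= x].
    by rewrite /b /Num.min; case: ifPn; rewrite -?leNgt => ?; split; lra.
  have [cA c0 cx] : [/\ c < A, 0 <= c & x <= c].
    by rewrite /c /Num.max; case: ifPn; rewrite -?leNgt => ?; split; lra.
  symmetry; apply: (@prim_FTC _ _ b c); rewrite ?b0 ?bx// => z /andP[bz zc].
    by apply: dF; apply/andP; split; lra.
  exact: cy.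
apply: (@near_eq_is_derive _ _ _ (fun x => F x - F 0)).
  have : \forall x \near s, x \in `](- A)%R, A[.
    by apply: near_in_itvoo; rewrite in_itv/= -ltr_norml.
  by apply: filterS => x; rewrite in_itv/= -ltr_norml; exact: FE.
rewrite -[y s]subr0; apply: (is_derive_subf _ (is_derive_cst (F 0) s 1)).
by apply: dF; move: sA; rewrite ltr_norml => /andP[? ?]; apply/andP; split; lra.
Qed.

Lemma prim_continuous y : continuous y -> continuous (prim y).
Proof. by move=> cy s; apply: is_derive_continuous; exact: prim_is_derive. Qed.

Lemma eq_prim y y' s : 0 <= s <= 1 -> (forall x : R, 0 <= x <= 1 -> y x = y' x) ->
  prim y s = prim y' s.
Proof.
move=> /andP[s0 s1] yE; congr (_ * _); apply: eq_int01 => t /andP[t0 t1].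
by rewrite yE// mulr_ge0//= mulr_ile1.
Qed.

Lemma prim_lin y y' c s : continuous y -> continuous y' ->
  prim (fun x => y x + c * y' x) s = prim y s + c * prim y' s.
Proof.
move=> cy cy'.
have cys z : continuous z -> continuous01 (fun t => z (s * t)).
  move=> cz; apply: continuous01W => t _.
  apply: (@continuous_comp _ _ _ (fun t : R => s * t) z); last exact: cz.
  by apply: continuousM; [exact: cst_continuous|].
rewrite /prim int01D ?int01Z; [ring|exact: cys..|].
apply: (cys (fun x => c * y' x)) => t.
by apply: continuousM; [exact: cst_continuous|exact: cy'].
Qed.

End primitive.

Section average_theory.
Context {R : realType}.
Implicit Types (g h : R -> R) (j : nat) (s t u v : R).

Lemma continuous_Jop j g : continuous g -> continuous (Jop j g).
Proof.
move=> cg s.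
apply: (@Jop_continuous R g (- (`|s| + 1)) (`|s| + 1)).
- by rewrite oppr_lt0 ltr_wpDl.
- by rewrite ltr_wpDl.
- by move=> x _; exact: cg.
- by rewrite in_itv/= -ltr_norml ltrDl.
Qed.

Lemma continuous_Jop_integrand j g s : continuous g ->
  continuous01 (fun t => t ^+ j * g (t ^+ 2 * s)).
Proof.
move=> cg; apply: continuous01W => t _.
by apply: continuousM; [exact: exprn_continuous|apply: continuous_comp_sqr; exact: cg].
Qed.

Lemma eq_Jop j g h s : 0 <= s <= 1 -> (forall x : R, 0 <= x <= 1 -> g x = h x) ->
  Jop j g s = Jop j h s.
Proof.
move=> s01 gh; congr (_ * _); apply: eq_int01 => t t01.
by rewrite gh// shrink_cc.
Qed.

Lemma Jop_lin j g h c s : continuous g -> continuous h ->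
  Jop j (fun x => g x + c * h x) s = Jop j g s + c * Jop j h s.
Proof.
move=> cg ch; have ig := continuous_Jop_integrand (j := j) (s := s) cg.
have ih := continuous_Jop_integrand (j := j) (s := s) ch.
rewrite /Jop [in LHS](_ : int01 _ = int01 (fun t => t ^+ j * g (t ^+ 2 * s))
  + c * int01 (fun t => t ^+ j * h (t ^+ 2 * s))); first ring.
rewrite -int01Z// -int01D//; first by apply: eq_int01 => t _; ring.
by move=> t; apply: cvgM; [exact: cvg_cst|exact: ih].
Qed.

Lemma Jop_cst j (c : R) s : Jop j (fun=> c) s = 2 * c / j.+1%:R.
Proof.
have E : int01 (fun t => t ^+ j * c)
    = c / j.+1%:R * 1 ^+ j.+1 - c / j.+1%:R * 0 ^+ j.+1.
  apply: (@int01_FTC _ (fun t => c / j.+1%:R * t ^+ j.+1)); last first.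
    move=> t _; apply: (is_derive_cast (is_derive_scalef _ (is_derive_expf j.+1 t))) => //.
    by rewrite /= mulrA divfK ?pnatr_eq0// mulrC.
  apply: continuous01W => t _.
  by apply: continuousM; [exact: exprn_continuous|exact: cst_continuous].
by rewrite /Jop E expr1n expr0n/= mulr0 subr0 mulr1 mulrA.
Qed.

Lemma Jop_ge0 j g u v s : u <= 0 -> 0 <= v -> u <= s <= v ->
  (forall x : R, u <= x <= v -> 0 <= g x) -> 0 <= Jop j g s.
Proof.
move=> u0 v0 suv g0; apply: mulr_ge0 => //; apply: int01_ge0 => t t01.
rewrite mulr_ge0 ?exprn_ge0//; first by case/andP: t01.
by rewrite g0// shrink_cc.
Qed.

Lemma Jop_le j g h u v s : continuous g -> continuous h ->
  u <= 0 -> 0 <= v -> u <= s <= v ->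
  (forall x : R, u <= x <= v -> g x <= h x) -> Jop j g s <= Jop j h s.
Proof.
move=> cg ch u0 v0 suv gh; rewrite -subr_ge0.
rewrite (_ : _ - _ = Jop j (fun x => h x + -1 * g x) s); last first.
  by rewrite Jop_lin// mulN1r.
by apply: Jop_ge0 suv _ => // x /gh; rewrite mulN1r subr_ge0.
Qed.

Lemma Jop_ndecr j g u v : continuous g -> u <= 0 -> 0 <= v ->
  (forall s t : R, u <= s -> s <= t -> t <= v -> g s <= g t) ->
  forall s t : R, u <= s -> s <= t -> t <= v -> Jop j g s <= Jop j g t.
Proof.
move=> cg u0 v0 gn s t us st tv; rewrite -subr_ge0 -mulrBr mulr_ge0//.
have is_ := continuous_Jop_integrand (j := j) (s := s) cg.
have it := continuous_Jop_integrand (j := j) (s := t) cg.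
rewrite -mulN1r -int01Z// -int01D//; last first.
  by move=> x; apply: cvgM; [exact: cvg_cst|exact: is_].
apply: int01_ge0 => x x01; rewrite mulN1r subr_ge0.
have /andP[x0 x1] := x01.
rewrite ler_wpM2l ?exprn_ge0//.
have /andP[? _] : u <= x ^+ 2 * s <= v by apply: shrink_cc => //; rewrite us (le_trans st).
have /andP[_ ?] : u <= x ^+ 2 * t <= v by apply: shrink_cc => //; rewrite tv (le_trans us).
by apply: gn => //; rewrite ler_wpM2l ?exprn_ge0.
Qed.

Lemma Jop_euler j g g' u v s : u < 0 -> 0 < v ->
  {in `]u, v[, forall x : R, is_derive x 1 g (g' x)} ->
  {in `]u, v[, forall x, {for x, continuous g'}} -> s \in `]u, v[ ->
  s * Jop j.+2 g' s + j.+1%:R / 2 * Jop j g s = g s.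
Proof.
move=> u0 v0 dg cg' sI.
have cg : {in `]u, v[, forall x, {for x, continuous g}}.
  by move=> x /dg; exact: is_derive_continuous.
have c1 := Jop_integrand (j := j.+2) u0 v0 cg' sI.
have c2 := Jop_integrand (j := j) u0 v0 cg sI.
have scale c h : continuous01 h -> continuous01 (fun t : R => c * h t).
  by move=> ch t; apply: cvgM; [exact: cvg_cst|exact: ch].
rewrite /Jop (_ : _ + _ = 2 * s * int01 (fun t => t ^+ j.+2 * g' (t ^+ 2 * s))
  + j.+1%:R * int01 (fun t => t ^+ j * g (t ^+ 2 * s))); last by field.
rewrite -!int01Z// -int01D; [|exact: scale..].
rewrite -[RHS]subr0 -[g s](_ : 1 ^+ j.+1 * g (1 ^+ 2 * s) = _); last first.
  by rewrite !expr1n !mul1r.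
rewrite -[X in _ = _ - X](_ : 0 ^+ j.+1 * g (0 ^+ 2 * s) = _); last first.
  by rewrite expr0n mul0r.
apply: (@int01_FTC _ (fun t => t ^+ j.+1 * g (t ^+ 2 * s))).
- move=> t; apply: cvgD; [exact: scale c1 _|exact: scale c2 _].
- move=> t t01; have /dg d1 := shrink_oo u0 v0 sI t01.
  have d2 := is_derive_compf (g := fun y => y ^+ 2)
    (is_derive_mulr s (t ^+ 2)) (is_derive_expf 2 t).
  have d3 := is_derive_mulf (is_derive_expf j.+1 t)
    (is_derive_compf (g := fun y => y ^+ 2 * s) d1 d2).
  apply: (is_derive_cast d3) => //.
  by rewrite /= expr1 !exprS; ring.
Qed.

(** The converse of [Jop_euler]: a C^1 function near [0, 1] is recovered from its image under s d/ds
    + (n+1)/2, the competing solutions being singular at 0. Both statements reduce to the same two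
    integrals. *)
Lemma Jop_representation n (f f' : R -> R) u v s : u < 0 -> 1 < v ->
  {in `]u, v[, forall x : R, is_derive x 1 f (f' x)} ->
  {in `]u, v[, forall x, {for x, continuous f'}} -> 0 <= s <= 1 ->
  Jop n (fun s => s * f' s + n.+1%:R / 2 * f s) s = f s.
Proof.
move=> u0 v1 df cf' /andP[s0 s1].
have sI : s \in `]u, v[ by rewrite in_itv/= (lt_le_trans u0)// (le_lt_trans s1).
have v0 : 0 < v by exact: lt_trans v1.
rewrite -(Jop_euler n u0 v0 df cf' sI).
have cf : {in `]u, v[, forall x, {for x, continuous f}}.
  by move=> x /df; exact: is_derive_continuous.
have c1 := Jop_integrand (j := n.+2) u0 v0 cf' sI.
have c2 := Jop_integrand (j := n) u0 v0 cf sI.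
have scale c h : continuous01 h -> continuous01 (fun t : R => c * h t).
  by move=> ch t; apply: cvgM; [exact: cvg_cst|exact: ch].
rewrite /Jop (_ : _ + _ = 2 * (s * int01 (fun t => t ^+ n.+2 * f' (t ^+ 2 * s))
  + n.+1%:R / 2 * int01 (fun t => t ^+ n * f (t ^+ 2 * s)))); last by ring.
rewrite -[s * _]int01Z// -[_ / 2 * _]int01Z// -int01D; [|exact: scale..].
by congr (_ * _); apply: eq_int01 => t _; rewrite !exprS; ring.
Qed.

End average_theory.

(** * The radial bilaplacian in the variable s = |x|^2 *)

Section bilaplace.
Context {R : realType}.
Variable n : nat.
Implicit Types (g h : R -> R) (s t u v : R).

(* Write D f = s f'' + (n + 1) / 2 f', a quarter of the Laplacian. [Zop g] is the
   solution of D^2 z = g with z(1) = z'(1) = 0, and [Eop g] is z''(1). *)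
Definition Pop g : R -> R := prim (Jop n g).
Definition Qop g : R -> R := Jop n (Pop g).
Definition Zop g s : R := prim (Qop g) s - prim (Qop g) 1 - Qop g 1 * (s - 1).
Definition Eop g : R := Pop g 1 - n.+1%:R / 2 * Qop g 1.

Lemma Pop_is_derive g s : continuous g -> is_derive s 1 (Pop g) (Jop n g s).
Proof. by move=> cg; apply: prim_is_derive; exact: continuous_Jop. Qed.

Lemma continuous_Pop g : continuous g -> continuous (Pop g).
Proof. by move=> cg; apply: prim_continuous; exact: continuous_Jop. Qed.

Lemma continuous_Qop g : continuous g -> continuous (Qop g).
Proof. by move=> cg; apply: continuous_Jop; exact: continuous_Pop. Qed.

Lemma Zop_is_derive g s : continuous g ->
  is_derive s 1 (Zop g) (Qop g s - Qop g 1).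
Proof.
move=> cg; have dQ := prim_is_derive s (continuous_Qop cg).
have d1 : is_derive s 1 (fun s => Qop g 1 * (s - 1)) (Qop g 1).
  apply: (is_derive_cast (is_derive_scalef (Qop g 1)
    (is_derive_subf (is_derive_id s 1) (is_derive_cst (1 : R) s 1)))) => //.
  by rewrite subr0 mulr1.
apply: (is_derive_cast (is_derive_subf (is_derive_subf dQ
  (is_derive_cst (prim (Qop g) 1) s 1)) d1)) => //.
by rewrite subr0.
Qed.

Lemma Zop1 g : Zop g 1 = 0.
Proof. by rewrite /Zop !subrr mulr0 subr0. Qed.

Lemma eq_Pop g h s : (forall x : R, 0 <= x <= 1 -> g x = h x) -> 0 <= s <= 1 ->
  Pop g s = Pop h s.
Proof. by move=> gh s01; apply: eq_prim => // x x01; exact: eq_Jop. Qed.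

Lemma eq_Qop g h s : (forall x : R, 0 <= x <= 1 -> g x = h x) -> 0 <= s <= 1 ->
  Qop g s = Qop h s.
Proof. by move=> gh s01; apply: eq_Jop => // x x01; exact: eq_Pop. Qed.

Lemma eq_Zop g h s : (forall x : R, 0 <= x <= 1 -> g x = h x) -> 0 <= s <= 1 ->
  Zop g s = Zop h s.
Proof.
move=> gh s01; rewrite /Zop.
rewrite (@eq_prim _ (Qop g) (Qop h) s)//; last by move=> x; exact: eq_Qop.
rewrite (@eq_prim _ (Qop g) (Qop h) 1) ?lexx ?ler01//; last by move=> x; exact: eq_Qop.
by rewrite (@eq_Qop g h 1)// lexx ler01.
Qed.

Lemma eq_Eop g h : (forall x : R, 0 <= x <= 1 -> g x = h x) -> Eop g = Eop h.
Proof. by move=> gh; rewrite /Eop (@eq_Qop g h)// ?(@eq_Pop g h)// lexx ler01. Qed.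

Lemma Pop_lin g h c : continuous g -> continuous h ->
  Pop (fun x => g x + c * h x) = (fun s => Pop g s + c * Pop h s).
Proof.
move=> cg ch; apply/funext => s; rewrite /Pop -prim_lin; [|exact: continuous_Jop..].
by congr prim; apply/funext => x; exact: Jop_lin.
Qed.

Lemma Qop_lin g h c s : continuous g -> continuous h ->
  Qop (fun x => g x + c * h x) s = Qop g s + c * Qop h s.
Proof.
by move=> cg ch; rewrite /Qop Pop_lin// Jop_lin//; exact: continuous_Pop.
Qed.

Lemma Zop_lin g h c s : continuous g -> continuous h ->
  Zop (fun x => g x + c * h x) s = Zop g s + c * Zop h s.
Proof.
move=> cg ch; rewrite /Zop.
have -> : Qop (fun x => g x + c * h x) = (fun s => Qop g s + c * Qop h s).
  by apply/funext => x; exact: Qop_lin.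
by rewrite !prim_lin; [ring|exact: continuous_Qop..].
Qed.

Lemma Eop_lin g h c : continuous g -> continuous h ->
  Eop (fun x => g x + c * h x) = Eop g + c * Eop h.
Proof. by move=> cg ch; rewrite /Eop Qop_lin// Pop_lin//; ring. Qed.

(** Homogeneity of all the operators follows from their [_lin] lemmas applied with both arguments
    equal to [g]. *)
Lemma scaleE c g : (fun x => c * g x) = (fun x => g x + (c - 1) * g x).
Proof. by apply/funext => x; ring. Qed.

Lemma Jop_scale j c g s : continuous g -> Jop j (fun x => c * g x) s = c * Jop j g s.
Proof. by move=> cg; rewrite scaleE Jop_lin//; ring. Qed.

Lemma Zop_scale c g s : continuous g -> Zop (fun x => c * g x) s = c * Zop g s.
Proof. by move=> cg; rewrite scaleE Zop_lin//; ring. Qed.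

Lemma Eop_scale c g : continuous g -> Eop (fun x => c * g x) = c * Eop g.
Proof. by move=> cg; rewrite scaleE Eop_lin//; ring. Qed.

Section comparison.
Variables u v : R.
Hypotheses (u0 : u <= 0) (v1 : 1 <= v).

Let v0 : 0 <= v. Proof. exact: le_trans v1. Qed.

Lemma Pop_ndecr g : continuous g -> (forall x : R, u <= x <= v -> 0 <= g x) ->
  forall s t : R, u <= s -> s <= t -> t <= v -> Pop g s <= Pop g t.
Proof.
move=> cg g0; apply: (is_derive_ndecr (df := Jop n g)) => x xuv.
  exact: Pop_is_derive.
exact: Jop_ge0 g0.
Qed.

Lemma Qop_ndecr g : continuous g -> (forall x : R, u <= x <= v -> 0 <= g x) ->
  forall s t : R, u <= s -> s <= t -> t <= v -> Qop g s <= Qop g t.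
Proof.
move=> cg g0; apply: Jop_ndecr => //; first exact: continuous_Pop.
exact: Pop_ndecr.
Qed.

(** The derivative [Qop g s - Qop g 1] is nonpositive before 1 and nonnegative after it, since
    [Qop g] is nondecreasing; so [Zop g] has its minimum 0 at s = 1, also when the interval extends
    beyond 1. *)
Lemma Zop_ge0 g s : continuous g -> (forall x : R, u <= x <= v -> 0 <= g x) ->
  u <= s <= v -> 0 <= Zop g s.
Proof.
move=> cg g0 /andP[us sv]; have Qn := Qop_ndecr cg g0.
have [s1|/ltW s1] := leP s 1.
- rewrite -(Zop1 g) -lerN2.
  apply: (@is_derive_ndecr R (fun x => - Zop g x)
    (fun x => - (Qop g x - Qop g 1)) s 1 _ _ s 1 (lexx s) s1 (lexx 1)).
    by move=> x _; exact: is_deriveN (Zop_is_derive x cg).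
  move=> x /andP[sx x1]; rewrite oppr_ge0 subr_le0.
  by apply: Qn => //; exact: le_trans sx.
- rewrite -(Zop1 g).
  apply: (@is_derive_ndecr R (Zop g) (fun x => (Qop g x - Qop g 1)) 1 s
    _ _ 1 s (lexx 1) s1 (lexx s)).
    by move=> x _; exact: Zop_is_derive.
  move=> x /andP[sx xs]; rewrite subr_ge0.
  by apply: Qn => //; [exact: le_trans ler01|exact: le_trans xs _].
Qed.

(** [Qop g 1] averages the values of the nondecreasing function [Pop g] on [0, 1], so it is at most
    the average of the constant [Pop g 1], which is [Pop g 1] divided by (n+1)/2. *)
Lemma Eop_ge0 g : continuous g -> (forall x : R, u <= x <= v -> 0 <= g x) -> 0 <= Eop g.
Proof.
move=> cg g0; have Pn := Pop_ndecr cg g0.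
have : Qop g 1 <= Jop n (fun=> Pop g 1) 1.
  apply: (@Jop_le _ n _ _ 0 1) => //.
  - exact: continuous_Pop.
  - exact: cst_continuous.
  - by rewrite ler01 lexx.
  - by move=> x /andP[x0 x1]; apply: Pn => //; exact: le_trans x0.
rewrite Jop_cst /Eop subr_ge0 => /(ler_wpM2l (_ : 0 <= n.+1%:R / 2)) H.
by apply: (le_trans (H _)); rewrite ?divr_ge0// le_eqVlt; apply/orP; left; apply/eqP; field.
Qed.

Variables g h : R -> R.
Hypotheses (cg : continuous g) (ch : continuous h).
Hypothesis gh : forall x, u <= x <= v -> g x <= h x.

Let d x := h x + -1 * g x.
Let cd : continuous d.
Proof.
move=> x; rewrite /d; apply: cvgD; first exact: ch.
by apply: cvgM; [exact: cvg_cst|exact: cg].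
Qed.
Let d0 x : u <= x <= v -> 0 <= d x.
Proof. by move=> /gh; rewrite /d mulN1r subr_ge0. Qed.

Lemma Zop_le s : u <= s <= v -> Zop g s <= Zop h s.
Proof. by move=> /(Zop_ge0 cd d0); rewrite Zop_lin// mulN1r subr_ge0. Qed.

Lemma Eop_le : Eop g <= Eop h.
Proof. by have := Eop_ge0 cd d0; rewrite Eop_lin// mulN1r subr_ge0. Qed.

Lemma Qop_osc_le s t : u <= s -> s <= t -> t <= v ->
  Qop g t - Qop g s <= Qop h t - Qop h s.
Proof.
move=> us st tv; have := Qop_ndecr cd d0 us st tv; rewrite !Qop_lin//.
rewrite -subr_ge0 => H; rewrite -subr_ge0; apply: le_trans H _.
by rewrite le_eqVlt; apply/orP; left; apply/eqP; ring.
Qed.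

End comparison.

Lemma Zop_ninc g s : continuous g -> (forall x : R, 0 <= x <= 1 -> 0 <= g x) ->
  0 <= s <= 1 -> Zop g s <= Zop g 0.
Proof.
move=> cg g0 /andP[s0 s1]; rewrite -lerN2.
apply: (@is_derive_ndecr R (fun x => - Zop g x)
  (fun x => - (Qop g x - Qop g 1)) 0 1 _ _ 0 s (lexx 0) s0 s1).
  by move=> x _; exact: is_deriveN (Zop_is_derive x cg).
move=> x /andP[x0 x1]; rewrite oppr_ge0 subr_le0.
exact: (@Qop_ndecr 0 1 (lexx 0) (lexx 1) g cg g0).
Qed.

(** A slope bound for [Zop] that depends on the source only through its upper bound [M]. The slope
    of [Zop g] at x is the difference of [Qop g] between x and 1; by [Qop_osc_le] it grows with the
    source, and for the constant [M] it is at most the total increase over [-1, 2]. *)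
Definition Qosc (M : R) := Qop (fun=> M) 2 - Qop (fun=> M) (-1).

Lemma Zop_lipschitz u v g M : -1 <= u -> u <= 0 -> 1 <= v -> v <= 2 ->
  continuous g -> (forall x : R, u <= x <= v -> 0 <= g x <= M) ->
  forall s t : R, u <= s <= v -> u <= t <= v ->
    `|Zop g s - Zop g t| <= Qosc M * `|s - t|.
Proof.
move=> u1 u0 v1 v2 cg gM.
apply: (is_derive_lipschitz (df := fun s => Qop g s - Qop g 1)) => x.
  by move=> _; exact: Zop_is_derive.
move=> /andP[ux xv].
have M0 : 0 <= M.
  by have /andP[g0 g1] := gM 0 (introT andP (conj u0 (le_trans ler01 v1))); exact: le_trans g1.
have cM : continuous (fun _ : R => M) by move=> ?; exact: cvg_cst.
have QM : forall s t : R, -1 <= s -> s <= t -> t <= 2 -> Qop (fun=> M) s <= Qop (fun=> M) t.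
  by apply: Qop_ndecr => //; lra.
have g0 y : u <= y <= v -> 0 <= g y by move=> /gM/andP[].
have gM' y : u <= y <= v -> g y <= M by move=> /gM/andP[].
have [x1|/ltW x1] := leP x 1.
- rewrite ler0_norm; last by rewrite subr_le0 (Qop_ndecr u0 v1 cg g0).
  rewrite opprB; apply: le_trans (Qop_osc_le u0 v1 cg cM gM' ux x1 v1) _.
  by apply: lerB; apply: QM; lra.
- rewrite ger0_norm; last by rewrite subr_ge0 (Qop_ndecr u0 v1 cg g0)//; lra.
  apply: le_trans (Qop_osc_le u0 v1 cg cM gM' (_ : u <= 1) x1 xv) _; first lra.
  by apply: lerB; apply: QM; lra.
Qed.

End bilaplace.

(** * Values of the solution operator on the bilaplacian of a known function *)

Section representation.
Context {R : realType}.
Variables (n : nat) (u v : R).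
Hypotheses (u0 : u < 0) (v1 : 1 < v).
Local Notation m := (n.+1%:R / 2 : R).

Let v0 : 0 < v. Proof. exact: lt_trans v1. Qed.
Let sub x : 0 <= x <= 1 -> x \in `]u, v[.
Proof.
by rewrite in_itv/= => /andP[x0 x1]; rewrite (lt_le_trans u0)// (le_lt_trans x1).
Qed.

Lemma Pop_representation (f f1 f2 : R -> R) s :
  {in `]u, v[, forall x : R, is_derive x 1 f (f1 x)} ->
  {in `]u, v[, forall x : R, is_derive x 1 f1 (f2 x)} ->
  {in `]u, v[, forall x, {for x, continuous f2}} -> 0 <= s <= 1 ->
  Pop n (fun s => s * f2 s + m * f1 s) s = f s - f 0.
Proof.
move=> df df1 cf2 s01; rewrite /Pop (@eq_prim _ _ f1)//; last first.
  by move=> x x01; exact: (Jop_representation n u0 v1 df1 cf2 x01).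
apply: (@prim_FTC _ f f1 0 1); rewrite ?lexx ?ler01//.
  by move=> x /sub; exact: df.
by move=> x /sub/df1; exact: is_derive_continuous.
Qed.

Variables f f1 f2 w w1 w2 : R -> R.
Hypotheses (df : {in `]u, v[, forall x : R, is_derive x 1 f (f1 x)})
  (df1 : {in `]u, v[, forall x : R, is_derive x 1 f1 (f2 x)})
  (cf2 : {in `]u, v[, forall x, {for x, continuous f2}})
  (wE : forall x, 0 <= x <= 1 -> w x = x * f2 x + m * f1 x)
  (dw : {in `]u, v[, forall x : R, is_derive x 1 w (w1 x)})
  (dw1 : {in `]u, v[, forall x : R, is_derive x 1 w1 (w2 x)})
  (cw2 : {in `]u, v[, forall x, {for x, continuous w2}}).
Let g s := s * w2 s + m * w1 s.

(** [Pop g] vanishes at 0 and so returns [w - w 0] instead of [w]; consequently [Qop g] returns [f1]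
    only up to the constant [c]. That constant cancels in [Zop], which becomes the first-order
    Taylor remainder of [f] at 1, and in [Eop], which becomes f''(1). *)
Let c := w 0 / m.
Let m0 : m != 0. Proof. by rewrite mulf_neq0// invr_neq0. Qed.

Let Qg s : 0 <= s <= 1 -> Qop n g s = f1 s - c.
Proof.
move=> s01; rewrite /Qop -(@Jop_representation R n (fun s => f1 s - c) f2 u v)//.
- apply: eq_Jop => // x x01; rewrite /g (Pop_representation dw dw1 cw2 x01) (wE x01).
  by rewrite mulrBr /c (mulrC m (_ / m)) divfK// addrA.
- move=> x /df1 d; apply: (is_derive_cast (is_derive_subf d (is_derive_cst c x 1))) => //.
  by rewrite subr0.
Qed.

Lemma Zop_representation s : 0 <= s <= 1 ->
  Zop n g s = f s - f 1 - f1 1 * (s - 1).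
Proof.
have P x : 0 <= x <= 1 -> prim (Qop n g) x = f x - f 0 - c * x.
  move=> x01; rewrite (@eq_prim _ _ (fun s => f1 s - c))//.
  have -> : f x - f 0 - c * x = (f x - c * x) - (f 0 - c * 0) by ring.
  apply: (@prim_FTC _ (fun s => f s - c * s) _ 0 1); rewrite ?lexx ?ler01//.
  - by move=> y /sub/df d; exact: is_derive_subf d (is_derive_mull c y).
  - move=> y /sub/df1/is_derive_continuous cf.
    by apply: continuousB => //; exact: cst_continuous.
have l1 : 0 <= (1 : R) <= 1 by rewrite ler01 lexx.
by move=> s01; rewrite /Zop (P _ s01) (P _ l1) (Qg l1); ring.
Qed.

Lemma Eop_representation : Eop n g = f2 1.
Proof.
have l1 : 0 <= (1 : R) <= 1 by rewrite ler01 lexx.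
rewrite /Eop (Qg l1) (Pop_representation dw dw1 cw2 l1) (wE l1) mulrBr /c (mulrC m (_ / m)) divfK//.
by ring.
Qed.

Lemma Jop1_representation : Jop n g 1 = w1 1.
Proof.
have l1 : 0 <= (1 : R) <= 1 by rewrite ler01 lexx.
exact: (Jop_representation n u0 v1 dw1 cw2 l1).
Qed.

End representation.

(** * Existence of radial solutions *)

Section lipschitz_fixpoint.
Context {R : realType}.
Implicit Types (f g : R -> R) (s t : R).

Definition lipschitz (L : R) f := forall s t, `|f s - f t| <= L * `|s - t|.

Lemma lipschitz_continuous L f : lipschitz L f -> continuous f.
Proof.
move=> fL s; apply/cvgrPdist_le => e e0.
have L1 : 0 < `|L| + 1 by rewrite ltr_wpDl.
near=> t; apply: (le_trans (fL s t)).
apply: (@le_trans _ _ ((`|L| + 1) * `|s - t|)).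
  by rewrite ler_wpM2r// (le_trans (ler_norm L))// lerDl.
rewrite -ler_pdivlMl//; near: t.
have e1 : 0 < (`|L| + 1)^-1 * e by rewrite mulr_gt0// invr_gt0.
by apply/nbhs_ballP; exists ((`|L| + 1)^-1 * e) => //= y /ltW.
Unshelve. all: by end_near. Qed.

(* Tarski's argument: the supremum of the subsolutions is a solution, and the
   class is closed under suprema because the Lipschitz constant is fixed. *)
Lemma lipschitz_fixpoint (L : R) (lo hi : R -> R) (Phi : (R -> R) -> R -> R) :
  let C f := lipschitz L f /\ forall s, lo s <= f s <= hi s in
  C lo -> (forall f, C f -> C (Phi f)) ->
  (forall f g, C f -> C g -> (forall s, f s <= g s) ->
     forall s, Phi f s <= Phi g s) ->
  exists2 f, C f & forall s, Phi f s = f s.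
Proof.
move=> C Clo PhiC Phi_le.
pose S : set (R -> R) := [set f | C f /\ forall s, f s <= Phi f s].
have Slo : S lo by split=> // s; have [_ /(_ s)/andP[]] := PhiC _ Clo.
pose A s : set R := [set f s | f in S].
have supA s : has_sup (A s).
  split; first by exists (lo s), lo.
  by exists (hi s) => _ [f [[_ /(_ s)/andP[_ ?]] _] <-].
pose F s := sup (A s).
have leF f : S f -> forall s, f s <= F s.
  by move=> Sf s; apply: ub_le_sup; [exact: (supA s).2|exists f].
have Fle s x : (forall f, S f -> f s <= x) -> F s <= x.
  by move=> H; apply: ge_sup; [exact: (supA s).1|move=> _ [f Sf <-]; exact: H].
have CF : C F.
  split.
    suff H s t : F s - F t <= L * `|s - t|.
      by move=> s t; rewrite ler_norml H andbT lerNl opprB distrC.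
    rewrite lerBlDr; apply: Fle => f Sf; have [[fL _] _] := Sf.
    have := le_trans (ler_norm _) (fL s t); rewrite lerBlDr => /le_trans; apply.
    by rewrite lerD2l leF.
  move=> s; rewrite leF//=; apply: Fle => f [[_ /(_ s)/andP[_ ?]] _].
  by [].
have F_le : forall s, F s <= Phi F s.
  move=> s; apply: Fle => f Sf; have [Cf fPhi] := Sf.
  by apply: (le_trans (fPhi s)); apply: Phi_le => //; exact: leF.
exists F => // s; apply/eqP; rewrite eq_le F_le andbT.
apply: leF; split; first exact: PhiC.
by apply: Phi_le => //; exact: PhiC.
Qed.

Definition clamp (a b s : R) : R := Num.max a (Num.min s b).

Lemma clamp_itv a b s : a <= b -> a <= clamp a b s <= b.
Proof. by move=> ab; rewrite /clamp le_max lexx/= ge_max ab ge_min lexx orbT. Qed.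

Lemma clamp_id a b s : a <= s <= b -> clamp a b s = s.
Proof. by move=> /andP[as_ sb]; rewrite /clamp (min_idPl sb) (max_idPr as_). Qed.

Lemma clamp_lipschitz a b : a <= b -> lipschitz 1 (clamp a b).
Proof.
move=> ab; suff H s t : s <= t -> `|clamp a b s - clamp a b t| <= 1 * `|s - t|.
  move=> s t; have [|/ltW] := leP s t; first exact: H.
  by rewrite distrC (distrC s); exact: H.
move=> st; rewrite mul1r (ler0_norm (_ : s - t <= 0)) ?subr_le0//.
rewrite ler_norml /clamp.
by case: (leP s b) => ?; case: (leP t b) => ?; case: (leP a s) => ?;
  case: (leP a t) => ?; rewrite ?(max_idPr ab); apply/andP; split; lra.
Qed.

Lemma clamp_dist a b a' b' s : a' <= a -> a <= b -> b <= b' -> a' <= s <= b' ->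
  `|s - clamp a b s| <= Num.max (a - a') (b' - b).
Proof.
move=> a'a ab bb' /andP[as_ sb].
have [H1 H2] : a - a' <= Num.max (a - a') (b' - b) /\
    b' - b <= Num.max (a - a') (b' - b).
  by rewrite !le_max !lexx orbT.
move: H1 H2; set M := Num.max _ _ => H1 H2; rewrite ler_norml /clamp.
by case: (leP s b) => ?; case: (leP a s) => ?; rewrite ?(max_idPr ab);
  apply/andP; split; lra.
Qed.

Lemma lipschitz_comp_clamp a b L f : a <= b -> 0 <= L ->
  (forall s t : R, a <= s <= b -> a <= t <= b -> `|f s - f t| <= L * `|s - t|) ->
  lipschitz L (fun s => f (clamp a b s)).
Proof.
move=> ab L0 fL s t; apply: (le_trans (fL _ _ (clamp_itv _ ab) (clamp_itv _ ab))).
by rewrite ler_wpM2l// (le_trans (clamp_lipschitz ab s t))// mul1r.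
Qed.

End lipschitz_fixpoint.

(** * The integral equation with the power source *)

Section nonlinear.
Context {R : realType}.
Variables (n : nat) (k p alpha : R).
Hypotheses (k0 : 0 <= k) (p0 : 0 <= p) (alpha0 : 0 < alpha).
Implicit Types (f g u v : R -> R) (s t : R).

Definition source f s : R := k * f s `^ p.

(* The solution of D^2 f = g with f(1) = alpha and f'(1) = - b. *)
Definition Top b g s : R := alpha + b * (1 - s) + Zop n g s.

Lemma powR_continuous (q x : R) : 0 < x -> {for x, continuous (fun y : R => y `^ q)}.
Proof. by move=> x0; exact: is_derive_continuous (is_derive1_powR q x0). Qed.

Lemma continuous_source f : continuous f -> (forall s, 0 < f s) ->
  continuous (source f).
Proof.
move=> cf f0 s; rewrite /source; apply: cvgM; first exact: cvg_cst.
apply: (@continuous_comp _ _ _ f (fun y : R => y `^ p)); first exact: cf.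
exact: powR_continuous.
Qed.

Lemma source_ge0 f s : 0 <= source f s.
Proof. by rewrite mulr_ge0 ?powR_ge0. Qed.

Lemma source_le f g s : 0 <= f s -> f s <= g s -> source f s <= source g s.
Proof.
move=> f0 fg; rewrite ler_wpM2l// ge0_ler_powR// nnegrE//.
exact: le_trans fg.
Qed.

Lemma Top_lipschitz (u v b M : R) g : -1 <= u -> u <= 0 -> 1 <= v -> v <= 2 -> 0 <= b ->
  continuous g -> (forall x : R, u <= x <= v -> 0 <= g x <= M) ->
  forall s t : R, u <= s <= v -> u <= t <= v ->
    `|Top b g s - Top b g t| <= (b + Qosc n M) * `|s - t|.
Proof.
move=> u1 u0 v1 v2 b0 cg gM s t us ut.
have := Zop_lipschitz n u1 u0 v1 v2 cg gM us ut.
have -> : Top b g s - Top b g t = b * (t - s) + (Zop n g s - Zop n g t).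
  by rewrite /Top; ring.
move=> H; rewrite mulrDl; apply: (le_trans (ler_normD _ _)); apply: lerD => //.
by rewrite normrM ger0_norm// distrC.
Qed.

Lemma Qosc_ge0 (M : R) : 0 <= M -> 0 <= Qosc n M.
Proof.
move=> M0; rewrite subr_ge0; apply: (@Qop_ndecr R n (-1) 2) => //; try lra.
by move=> ?; exact: cvg_cst.
Qed.

(* The slope b + c * Eop encodes the boundary condition: c = 0 for (P_1) and
   c = 2 / (n - 1) for (P_2). *)
Lemma exists_solution (b c : R) v : 0 <= b -> 0 <= c -> continuous v ->
  (forall s, 0 < v s) ->
  (forall s : R, 0 <= s <= 1 -> Top (b + c * Eop n (source v)) (source v) s <= v s) ->
  exists u L M, [/\ 0 <= L, lipschitz L u, forall s, alpha <= u s <= M &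
    forall s : R, 0 <= s <= 1 ->
      u s <= v s /\ u s = Top (b + c * Eop n (source u)) (source u) s].
Proof.
move=> b0 c0 cv v0 Tv.
have [c1 _ vM] := EVT_max ler01 (continuous_subspaceT cv).
pose M := v c1.
have u01 s : 0 <= clamp 0 1 s <= (1 : R) by exact: clamp_itv.
have E0 f : continuous f -> (forall s, 0 < f s) -> 0 <= Eop n (source f).
  move=> cf f0; apply: (@Eop_ge0 R n 0 1) => //; first exact: continuous_source.
  by move=> x _; exact: source_ge0.
have Z0 f s : continuous f -> (forall s, 0 < f s) -> 0 <= s <= 1 ->
    0 <= Zop n (source f) s.
  move=> cf f0; apply: (@Zop_ge0 R n 0 1) => //; first exact: continuous_source.
  by move=> x _; exact: source_ge0.
have T_ge f s : continuous f -> (forall s, 0 < f s) -> 0 <= s <= 1 ->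
    alpha <= Top (b + c * Eop n (source f)) (source f) s.
  move=> cf f0 s01; rewrite /Top -addrA lerDl addr_ge0 ?Z0// mulr_ge0//.
    by rewrite addr_ge0// mulr_ge0// E0.
  by rewrite subr_ge0; case/andP: s01.
have vge s : 0 <= s <= 1 -> alpha <= v s.
  by move=> s01; apply: le_trans (Tv s s01); exact: T_ge.
have vM' s : 0 <= s <= 1 -> v s <= M by move=> s01; apply: vM; rewrite in_itv.
have M0 : 0 <= k * M `^ p by rewrite mulr_ge0// powR_ge0.
have cM : continuous (fun _ : R => k * M `^ p) by move=> ?; exact: cvg_cst.
have EM0 : 0 <= Eop n (fun=> k * M `^ p).
  by apply: (@Eop_ge0 R n 0 1).
pose L := b + c * Eop n (fun=> k * M `^ p) + Qosc n (k * M `^ p).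
have L0 : 0 <= L.
  by apply: addr_ge0; [apply: addr_ge0 => //; exact: mulr_ge0|exact: Qosc_ge0].
(* Precomposing with [clamp 0 1] makes the functions total and Lipschitz on the line while only
   their values on [0, 1] matter. *)
pose Phi f s := Top (b + c * Eop n (source f)) (source f) (clamp 0 1 s).
pose lo : R -> R := cst alpha; pose hi s := v (clamp 0 1 s).
pose C f := lipschitz L f /\ forall s, lo s <= f s <= hi s.
have Cpos f : C f -> forall s, 0 < f s.
  by move=> [_ H] s; apply: (lt_le_trans alpha0); have /andP[] := H s.
have Ccont f : C f -> continuous f by move=> [/lipschitz_continuous].
have CM f s : C f -> source f s <= k * M `^ p.
  move=> Cf; have [_ /(_ s)/andP[_ fM]] := Cf.
  rewrite ler_wpM2l// ge0_ler_powR// ?nnegrE ?(ltW (Cpos _ Cf s))//.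
    by rewrite (le_trans (ltW alpha0))// (le_trans (vge _ (u01 s)))// vM'.
  by rewrite (le_trans fM)// vM'.
have Clo : C lo.
  split=> [s t|s]; first by rewrite /lo/= subrr normr0; exact: mulr_ge0.
  by rewrite lexx/= vge.
have Phi_le f g : continuous f -> (forall s, 0 < f s) ->
    continuous g -> (forall s, 0 < g s) ->
    (forall s : R, 0 <= s <= 1 -> f s <= g s) -> forall s, Phi f s <= Phi g s.
  move=> cf f0 cg g0 fg s; rewrite /Phi /Top -!addrA lerD2l.
  have fg' x : 0 <= x <= 1 -> source f x <= source g x.
    by move=> x01; apply: source_le; rewrite ?fg// ltW.
  have csf := continuous_source cf f0; have csg := continuous_source cg g0.
  apply: lerD; last exact: (@Zop_le R n 0 1).
  rewrite ler_wpM2r//; first by rewrite subr_ge0; case/andP: (u01 s).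
  by rewrite lerD2l ler_wpM2l// (@Eop_le R n 0 1).
have PhiC f : C f -> C (Phi f).
  move=> Cf; have f0 := Cpos _ Cf; have cf := Ccont _ Cf.
  have EM : Eop n (source f) <= Eop n (fun=> k * M `^ p).
    apply: (@Eop_le R n 0 1) => //; first exact: continuous_source.
    by move=> x _; exact: CM.
  split.
    apply: lipschitz_comp_clamp => // s t s01 t01.
    have BB : 0 <= b + c * Eop n (source f) by rewrite addr_ge0// mulr_ge0// E0.
    apply: (le_trans (@Top_lipschitz 0 1 _ (k * M `^ p) _ _ _ _ _ BB
      (continuous_source cf f0) _ s t s01 t01)) => //; try lra.
      by move=> x _; rewrite source_ge0 CM.
    by rewrite ler_wpM2r// /L lerD2r lerD2l ler_wpM2l.
  move=> s; rewrite T_ge//=; apply: le_trans (Tv _ (u01 s)).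
  apply: Phi_le => // x x01; have [_ /(_ x)/andP[_]] := Cf.
  by rewrite /hi clamp_id.
have [u Cu uE] := lipschitz_fixpoint Clo PhiC
  (fun f g Cf Cg fg => Phi_le f g (Ccont _ Cf) (Cpos _ Cf) (Ccont _ Cg) (Cpos _ Cg)
    (fun s _ => fg s)).
have [uL ub] := Cu.
exists u, L, M; split=> // s.
  by have /andP[-> /le_trans] := ub s; apply; exact: vM'.
move=> s01; split; last by rewrite -[LHS]uE /Phi clamp_id.
by have /andP[_] := ub s; rewrite /hi clamp_id.
Qed.

(* Beyond s = 1 the operator with c > 0 is no longer monotone, so the slope is
   frozen at the value found on [0, 1]. *)
Lemma extend_solution (b L M : R) u : 0 <= b -> 0 <= L -> lipschitz L u ->
  (forall s, alpha <= u s <= M) ->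
  (forall s : R, 0 <= s <= 1 -> u s = Top b (source u) s) ->
  exists f d, [/\ 0 < d, continuous f, forall s, 0 < f s,
    forall s : R, 0 <= s <= 1 -> f s = u s &
    forall s : R, - d <= s <= 1 + d -> f s = Top b (source f) s].
Proof.
move=> b0 L0 uL uM uE.
have Malpha : alpha <= M by have /andP[/le_trans] := uM 0; apply.
pose Q := k * (M + 1) `^ p.
have Q0 : 0 <= Q by rewrite mulr_ge0// powR_ge0.
pose K := b + Qosc n Q.
have K0 : 0 <= K by rewrite addr_ge0// Qosc_ge0.
have K1 : 0 < K + 1 by rewrite ltr_wpDl.
(* With [K] bounding the slope of the operator, functions starting from values of [u] on [0, 1] move
   by at most [K * d] on the extra pieces. This is kept below [alpha / 2], for positivity, and below
   1, for the upper bound [M + 1]; [d <= 1] keeps the interval inside [-1, 2], as [Qosc]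
   requires. *)
pose d := Num.min 1 (Num.min 1 (alpha / 2) / (K + 1)).
have d0 : 0 < d.
  by rewrite lt_min ltr01 divr_gt0// lt_min ltr01 divr_gt0.
have d1 : d <= 1 by rewrite ge_min lexx.
have Kd : K * d <= Num.min 1 (alpha / 2).
  have h : d <= Num.min 1 (alpha / 2) / (K + 1) by rewrite ge_min lexx orbT.
  rewrite ler_pdivlMr// in h; apply: le_trans h; rewrite mulrC ler_wpM2l ?(ltW d0)//.
  by rewrite lerDl.
have Kd1 : K * d <= 1 by apply: (le_trans Kd); rewrite ge_min lexx.
have Kd2 : K * d <= alpha / 2 by apply: (le_trans Kd); rewrite ge_min lexx orbT.
have dd : - d <= 1 + d by lra.
pose cl := clamp (- d) (1 + d).
have cl_itv s : - d <= cl s <= 1 + d by exact: clamp_itv.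
pose e s := `|s - clamp 0 1 s|.
have e_lip s t : `|e s - e t| <= 2 * `|s - t|.
  rewrite /e; apply: (le_trans (ler_dist_dist _ _)).
  rewrite (_ : _ - _ - _ = (s - t) - (clamp 0 1 s - clamp 0 1 t)); last by ring.
  apply: (le_trans (ler_normB _ _)).
  rewrite (_ : 2 * _ = `|s - t| + 1 * `|s - t|); last by ring.
  by rewrite lerD2l; exact: clamp_lipschitz.
have e_le s : - d <= s <= 1 + d -> e s <= d.
  move=> sd; have H : Num.max (0 - - d) (1 + d - 1) <= d.
    by rewrite ge_max; apply/andP; split; lra.
  by apply: le_trans H; apply: clamp_dist => //; lra.
have e01 s : 0 <= s <= 1 -> e s = 0 by move=> s01; rewrite /e clamp_id// subrr normr0.
(* The barriers leave [u] at rate [K] times the distance [e] to [0, 1]. They coincide on [0, 1],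
   which forces every function of the class to equal [u] there. *)
pose lo0 s := u (clamp 0 1 s) - K * e s; pose hi0 s := u (clamp 0 1 s) + K * e s.
pose lo s := lo0 (cl s); pose hi s := hi0 (cl s).
pose L' := L + 2 * K.
have L'0 : 0 <= L' by rewrite addr_ge0// mulr_ge0.
pose C f := lipschitz L' f /\ forall s, lo s <= f s <= hi s.
have Ccont f : C f -> continuous f by move=> [/lipschitz_continuous].
have Clow f : C f -> forall s, alpha / 2 <= f s.
  move=> [_ H] s; have /andP[Hs _] := H s; apply: le_trans Hs.
  have /andP[Hu _] := uM (clamp 0 1 (cl s)).
  have : K * e (cl s) <= K * d by rewrite ler_wpM2l// e_le.
  by rewrite /lo /lo0; lra.
have Cpos f : C f -> forall s, 0 < f s.
  by move=> /Clow H s; apply: lt_le_trans (H s); rewrite divr_gt0.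
have Cup f : C f -> forall s, f s <= M + 1.
  move=> [_ H] s; have /andP[_ Hs] := H s; apply: (le_trans Hs).
  have /andP[_ Hu] := uM (clamp 0 1 (cl s)).
  have : K * e (cl s) <= K * d by rewrite ler_wpM2l// e_le.
  by rewrite /hi /hi0; lra.
have CQ f s : C f -> source f s <= Q.
  move=> Cf; rewrite ler_wpM2l// ge0_ler_powR// ?nnegrE ?(ltW (Cpos _ Cf s))//.
    by move: (Cup _ Cf s) (Cpos _ Cf s); lra.
  exact: Cup.
have Cu f s : C f -> 0 <= s <= 1 -> f s = u s.
  move=> [_ H] s01; have := H s; rewrite /lo /hi /cl clamp_id; last first.
    by case/andP: s01 => ? ?; apply/andP; split; lra.
  by rewrite /lo0 /hi0 e01// mulr0 subr0 addr0 clamp_id// => /le_anti.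
pose Phi f s := Top b (source f) (cl s).
have Clo : C lo.
  split; last first.
    move=> s; have : 0 <= K * e (cl s) by rewrite mulr_ge0 ?normr_ge0.
    by rewrite lexx /lo /hi /lo0 /hi0/=; lra.
  apply: lipschitz_comp_clamp => // s t _ _; rewrite /lo0.
  have -> : u (clamp 0 1 s) - K * e s - (u (clamp 0 1 t) - K * e t)
    = (u (clamp 0 1 s) - u (clamp 0 1 t)) - K * (e s - e t) by ring.
  have -> : L' * `|s - t| = L * `|s - t| + K * (2 * `|s - t|) by rewrite /L'; ring.
  apply: (le_trans (ler_normB _ _)); apply: lerD.
    apply: (le_trans (uL _ _)); rewrite ler_wpM2l//.
    by apply: (le_trans (clamp_lipschitz ler01 _ _)); rewrite mul1r.
  by rewrite normrM (ger0_norm K0) ler_wpM2l.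
have PhiC f : C f -> C (Phi f).
  move=> Cf; have f0 := Cpos _ Cf; have cf := Ccont _ Cf.
  have TL : forall s t, - d <= s <= 1 + d -> - d <= t <= 1 + d ->
      `|Top b (source f) s - Top b (source f) t| <= K * `|s - t|.
    apply: Top_lipschitz => //; try lra; first exact: continuous_source.
    by move=> x _; rewrite source_ge0 CQ.
  split.
    apply: lipschitz_comp_clamp => // s t sd td; apply: (le_trans (TL s t sd td)).
    by rewrite ler_wpM2r// /L'; lra.
  move=> s; rewrite /lo /hi /lo0 /hi0.
  have c01 : 0 <= clamp 0 1 (cl s) <= (1 : R) by exact: clamp_itv.
  (* On [0, 1] the operator sees the source on [0, 1] only, where [f] is [u]; so [Phi f] still
     equals [u] there, and the slope bound [K] keeps it between the barriers elsewhere. *)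
  have -> : u (clamp 0 1 (cl s)) = Top b (source f) (clamp 0 1 (cl s)).
    rewrite uE// /Top; congr (_ + _); apply: eq_Zop => // x x01.
    by rewrite /source (Cu f).
  have cd : - d <= clamp 0 1 (cl s) <= 1 + d.
    by case/andP: c01 => ? ?; apply/andP; split; lra.
  have := TL _ _ (cl_itv s) cd.
  by rewrite -/(e (cl s)) ler_norml /Phi => /andP[? ?]; apply/andP; split; lra.
have Phi_le f g : C f -> C g -> (forall s, f s <= g s) ->
    forall s, Phi f s <= Phi g s.
  move=> Cf Cg fg s; rewrite /Phi /Top lerD2l.
  apply: (@Zop_le R n (- d) (1 + d)) => //; try lra.
  - exact: continuous_source (Ccont _ Cf) (Cpos _ Cf).
  - exact: continuous_source (Ccont _ Cg) (Cpos _ Cg).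
  - by move=> x _; apply: source_le => //; rewrite ltW// Cpos.
have [f Cf fE] := lipschitz_fixpoint Clo PhiC Phi_le.
exists f, d; split=> //.
- exact: Ccont.
- exact: Cpos.
- by move=> s; exact: Cu.
- by move=> s sd; rewrite -[LHS]fE /Phi /cl clamp_id.
Qed.

Theorem radial_existence (b c : R) v : 0 <= b -> 0 <= c -> continuous v ->
  (forall s, 0 < v s) ->
  (forall s : R, 0 <= s <= 1 -> Top (b + c * Eop n (source v)) (source v) s <= v s) ->
  exists f d, [/\ 0 < d, continuous f, forall s, 0 < f s,
    forall s : R, 0 <= s <= 1 -> f s <= v s &
    forall s : R, - d <= s <= 1 + d ->
      f s = Top (b + c * Eop n (source f)) (source f) s].
Proof.
move=> b0 c0 cv v0 Tv.
have [u [L [M [L0 uL uM uE]]]] := exists_solution b0 c0 cv v0 Tv.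
have cu := lipschitz_continuous uL.
have u0 s : 0 < u s by have /andP[/(lt_le_trans alpha0)] := uM s.
have B0 : 0 <= b + c * Eop n (source u).
  rewrite addr_ge0// mulr_ge0// (@Eop_ge0 R n 0 1)//; first exact: continuous_source.
  by move=> x _; exact: source_ge0.
have [f [d [d0 cf f0 fu fE]]] := extend_solution B0 L0 uL uM (fun s h => (uE s h).2).
exists f, d; split=> //; first by move=> s s01; rewrite fu//; exact: (uE s s01).1.
by rewrite (@eq_Eop R n (source f) (source u))// => x x01; rewrite /source fu.
Qed.

End nonlinear.

(** * Regularity *)

Section regularity.
Context {R : realType}.
Variables u v : R.
Implicit Types (f g : R -> R) (k : nat) (c q : R).

(** The derivative is an existential witness constrained on the interval only, so each closure
    property is an induction on [k] that exhibits a formula for it. *)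
Fixpoint Ck k f : Prop :=
  if k is k'.+1 then
    exists2 f', {in `]u, v[, forall x : R, is_derive x 1 f (f' x)} & Ck k' f'
  else {in `]u, v[, forall x : R, {for x, continuous f}}.

Definition smooth_itv f := forall k, Ck k f.

Lemma near_itv (f g : R -> R) (x : R) : x \in `]u, v[ -> {in `]u, v[, f =1 g} ->
  \forall y \near x, f y = g y.
Proof.
move=> xI fg; have : \forall y \near x, y \in `]u, v[ by exact: near_in_itvoo.
by apply: filterS => y /fg.
Qed.

Lemma eq_Ck k f g : {in `]u, v[, f =1 g} -> Ck k f -> Ck k g.
Proof.
case: k => [|k] /= fg.
  move=> cf x xI; have cfx : f y @[y --> x] --> g x by rewrite -(fg x xI); exact: cf.
  apply: cvg_trans cfx; apply: near_eq_cvg.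
  by apply: near_itv => // y yI; rewrite fg.
move=> [f' df Cf']; exists f' => // x xI.
by apply: (near_eq_is_derive _ (df x xI)); exact: near_itv.
Qed.

Lemma CkW k f : Ck k.+1 f -> Ck k f.
Proof.
elim: k f => [|k IH] f [f' df Cf'].
  by move=> x /df/is_derive_continuous.
by exists f' => //; exact: IH.
Qed.

Lemma Ck_continuous k f : Ck k f -> {in `]u, v[, forall x : R, {for x, continuous f}}.
Proof. by elim: k f => // k IH f /CkW/IH. Qed.

Lemma Ck_cst k c : Ck k (fun=> c).
Proof.
elim: k c => [|k IH] c; first by move=> x _; exact: cst_continuous.
by exists (fun=> 0) => // x _; exact: is_derive_cst.
Qed.

Lemma Ck_add k f g : Ck k f -> Ck k g -> Ck k (fun x => f x + g x).
Proof.
elim: k f g => [|k IH] f g.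
  by move=> cf cg x xI; apply: cvgD; [exact: cf|exact: cg].
move=> [f' df Cf'] [g' dg Cg']; exists (fun x => f' x + g' x); last exact: IH.
by move=> x xI; apply: is_derive_addf; [exact: df|exact: dg].
Qed.

Lemma Ck_mul k f g : Ck k f -> Ck k g -> Ck k (fun x => f x * g x).
Proof.
elim: k f g => [|k IH] f g.
  by move=> cf cg x xI; apply: cvgM; [exact: cf|exact: cg].
move=> Cf Cg; have [[f' df Cf'] [g' dg Cg']] := (Cf, Cg).
exists (fun x => f x * g' x + g x * f' x).
  by move=> x xI; apply: is_derive_mulf; [exact: df|exact: dg].
by apply: Ck_add; apply: IH => //; exact: CkW.
Qed.

Lemma Ck_powR k q f : {in `]u, v[, forall x, 0 < f x} -> Ck k f ->
  Ck k (fun x => f x `^ q).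
Proof.
move=> f0; elim: k q f f0 => [|k IH] q f f0.
  move=> cf x xI; apply: (@continuous_comp _ _ _ f (fun y : R => y `^ q)).
    exact: cf.
  by apply: powR_continuous; exact: f0.
move=> Cf; have [f' df Cf'] := Cf.
exists (fun x => q * f x `^ (q - 1) * f' x).
  move=> x xI.
  exact: (is_derive_compf (is_derive1_powR q (f0 x xI)) (df x xI)).
apply: Ck_mul => //; apply: Ck_mul; first exact: Ck_cst.
by apply: IH => //; exact: CkW.
Qed.

Lemma Ck_Jop k j f : u < 0 -> 0 < v -> Ck k f -> Ck k (Jop j f).
Proof.
move=> u0 v0; elim: k j f => [|k IH] j f; first exact: Jop_continuous.
move=> [f' df Cf']; exists (Jop j.+2 f'); last exact: IH.
by apply: Jop_is_derive => //; exact: Ck_continuous Cf'.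
Qed.

Lemma smooth_itv_derive f : smooth_itv f ->
  {in `]u, v[, forall x : R, is_derive x 1 f (f^`()%classic x)} /\
  smooth_itv (f^`())%classic.
Proof.
move=> Sf; have df : {in `]u, v[, forall x : R, is_derive x 1 f (f^`()%classic x)}.
  move=> x xI; have [f' /(_ x xI) df _] := Sf 1.
  by have [Df _] := df; apply: (DeriveDef Df); rewrite derive1E.
split=> // k; have [f' df' Cf'] := Sf k.+1.
apply: eq_Ck Cf' => x xI.
by have [_ <-] := df' x xI; rewrite derive1E.
Qed.

End regularity.

Section solution_regularity.
Context {R : realType}.
Variables (n : nat) (k p alpha b d : R) (f : R -> R).
Hypotheses (d0 : 0 < d) (cf : continuous f) (f0 : forall s, 0 < f s).
Hypothesis fE : forall s : R, - d <= s <= 1 + d ->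
  f s = Top n alpha b (source k p f) s.
Local Notation g := (source k p f).
Local Notation m := (n.+1%:R / 2 : R).

Let u0 : - d < 0. Proof. by rewrite oppr_lt0. Qed.
Let v0 : 0 < 1 + d. Proof. by rewrite addr_gt0. Qed.
Let cg : continuous g. Proof. exact: continuous_source. Qed.

(* f', f'' and D f for the solution f. *)
Definition sol1 s := Qop n g s - Qop n g 1 - b.
Definition sol2 := Jop n.+2 (Jop n g).
Definition lap0 s := Pop n g s - m * (Qop n g 1 + b).

Lemma solution_derive1 :
  {in `](- d)%R, (1 + d)%R[, forall x : R, is_derive x 1 f (sol1 x)}.
Proof.
move=> x xI; have dZ := Zop_is_derive n x cg.
have d1 : is_derive x 1 (fun s : R => b * (1 - s)) (- b).
  apply: (is_derive_cast (is_derive_scalef b (is_derive_subf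
    (is_derive_cst (1 : R) x 1) (is_derive_id x 1)))) => //.
  by rewrite sub0r mulrN1.
have dT := is_derive_addf (is_derive_addf (is_derive_cst alpha x 1) d1) dZ.
apply: (near_eq_is_derive (f := Top n alpha b g)).
  by apply: (near_itv xI) => y /subset_itv_oo_cc; rewrite in_itv/= => /fE.
by apply: (is_derive_cast dT) => //; rewrite /sol1; ring.
Qed.

Lemma solution_derive2 :
  {in `](- d)%R, (1 + d)%R[, forall x : R, is_derive x 1 sol1 (sol2 x)}.
Proof.
move=> x xI.
have dQ : is_derive x 1 (Qop n g) (sol2 x).
  apply: (Jop_is_derive n u0 v0 _ _ xI) => y _; first exact: Pop_is_derive.
  exact: continuous_Jop.
apply: (is_derive_cast (is_derive_subf (is_derive_subf dQ
  (is_derive_cst (Qop n g 1) x 1)) (is_derive_cst b x 1))) => //.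
by rewrite !subr0.
Qed.

Lemma Qop_euler s : s \in `](- d)%R, (1 + d)%R[ ->
  s * sol2 s + m * Qop n g s = Pop n g s.
Proof.
apply: Jop_euler => // x _; first exact: Pop_is_derive.
exact: continuous_Jop.
Qed.

Lemma solution_lap : {in `](- d)%R, (1 + d)%R[, forall s,
  s * sol2 s + m * sol1 s = lap0 s}.
Proof. by move=> s sI; rewrite /lap0 -(Qop_euler sI) /sol1; ring. Qed.

Lemma lap0_derive (x : R) : is_derive x 1 lap0 (Jop n g x).
Proof.
apply: (is_derive_cast (is_derive_subf (Pop_is_derive n x cg)
  (is_derive_cst (m * (Qop n g 1 + b)) x 1))) => //.
by rewrite subr0.
Qed.

Lemma solution_boundary : sol1 1 = - b /\ sol2 1 = Eop n g.
Proof.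
split; first by rewrite /sol1 subrr sub0r.
have I1 : 1 \in `](- d)%R, (1 + d)%R[.
  by rewrite in_itv/= (lt_trans u0)//= ltrDl.
by rewrite /Eop -(Qop_euler I1) mul1r addrK.
Qed.

(** Bootstrap: if [f] is C^j then so is its source, as [f] is positive; the averages and primitives
    preserve this, so [sol1], the derivative of [f], is C^j. *)
Lemma solution_Ck j : Ck (- d) (1 + d) j f.
Proof.
elim: j => [|j IH]; first by move=> x _; exact: cf.
exists sol1; first exact: solution_derive1.
have Cg : Ck (- d) (1 + d) j g.
  by apply: Ck_mul; [exact: Ck_cst|apply: Ck_powR => // x _].
have CP : Ck (- d) (1 + d) j (Pop n g).
  apply: CkW; exists (Jop n g); last exact: Ck_Jop.
  by move=> x _; exact: Pop_is_derive.
apply: Ck_add; last exact: Ck_cst.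
by apply: Ck_add; [exact: Ck_Jop|exact: Ck_cst].
Qed.

Lemma bilap_solution : exists w2,
  {in `](- d)%R, (1 + d)%R[, forall x : R, is_derive x 1 (Jop n g) (w2 x)} /\
  {in `](- d)%R, (1 + d)%R[, forall s, s * w2 s + m * Jop n g s = g s}.
Proof.
have Cg j : Ck (- d) (1 + d) j g.
  apply: Ck_mul; first exact: Ck_cst.
  by apply: Ck_powR => //; exact: solution_Ck.
have [g' dg cg'] := Cg 1; exists (Jop n.+2 g'); split.
  exact: Jop_is_derive.
by move=> s; exact: Jop_euler.
Qed.

End solution_regularity.

(** * Radial functions on the ball *)

Section radial_calculus.
Context {R : realType} {n : nat}.
Local Notation V := 'rV[R]_n.+1.
Implicit Types (x y w : V) (f : R -> R) (U : V -> R).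

Definition sqn x : R := \sum_i x 0 i ^+ 2.
Definition dot x w : R := \sum_i x 0 i * w 0 i.

Lemma sqn_ge0 x : 0 <= sqn x.
Proof. by apply: sumr_ge0 => i _; exact: sqr_ge0. Qed.

Lemma enormE x : enorm x = Num.sqrt (sqn x).
Proof. by []. Qed.

Lemma sqnE x : sqn x = enorm x ^+ 2.
Proof. by rewrite enormE sqr_sqrtr// sqn_ge0. Qed.

Lemma dot_delta x i : dot x (delta_mx 0 i) = x 0 i.
Proof.
rewrite /dot (bigD1 i)//= mxE !eqxx mulr1 big1 ?addr0// => j ji.
by rewrite mxE eqxx/= (negbTE ji) mulr0.
Qed.

Lemma dotZr x w (c : R) : dot x (c *: w) = c * dot x w.
Proof. by rewrite /dot mulr_sumr; apply: eq_bigr => i _; rewrite mxE mulrCA. Qed.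

Lemma sqnZ x (c : R) : sqn (c *: x) = c ^+ 2 * sqn x.
Proof. by rewrite /sqn mulr_sumr; apply: eq_bigr => i _; rewrite mxE exprMn. Qed.

Lemma sqn_line x w (h : R) : sqn (h *: w + x) = sqn x + 2 * dot x w * h + sqn w * h ^+ 2.
Proof.
rewrite /sqn /dot mulr_sumr !mulr_suml -!big_split/=; apply: eq_bigr => i _.
by rewrite !mxE; ring.
Qed.

(** Directional derivatives become derivatives in one real variable; along a line [sqn] is a
    quadratic polynomial, so the chain rule on the real line suffices for radial functions. *)
Lemma is_derive_line U x w (d : R) :
  is_derive (0 : R) 1 (fun h : R => U (h *: w + x)) d -> is_derive x w U d.
Proof.
move=> [D <-]; have DU : derivable U x w := (derivable1P U x w).2 D.
apply: (DeriveDef DU); rewrite /derive.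
suff -> : (fun h : R => h^-1 *: ((U \o shift x) (h *: w) - U x)) = (fun h : R =>
  h^-1 *: (((fun h : R => U (h *: w + x)) \o shift 0) (h *: 1) - U (0 *: w + x))) by [].
by apply/funext => h /=; rewrite addr0 scale0r add0r [h *: 1]mulr1.
Qed.

Lemma is_derive_coord x w i : is_derive x w (fun y : V => y 0 i) (w 0 i).
Proof.
apply: is_derive_line.
apply: (is_derive_cast (is_derive_addf (is_derive_mulr (w 0 i) 0)
  (is_derive_cst (x 0 i) (0 : R) 1))) => [h|]; last by rewrite addr0.
by rewrite !mxE.
Qed.

Lemma is_derive_radial f x w (df : R) : is_derive (sqn x) 1 f df ->
  is_derive x w (fun y => f (sqn y)) (df * (2 * dot x w)).
Proof.
move=> Df; apply: is_derive_line.
have D1 : is_derive (0 : R) 1 (fun h => sqn (h *: w + x)) (2 * dot x w).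
  apply: (is_derive_cast (is_derive_addf (is_derive_addf
    (is_derive_cst (sqn x) (0 : R) 1) (is_derive_mull (2 * dot x w) 0))
    (is_derive_scalef (sqn w) (is_derive_expf 2 0)))) => [h|].
    by rewrite sqn_line.
  by rewrite expr1 !mulr0 addr0 add0r.
have D2 : is_derive (sqn (0 *: w + x)) 1 f df by rewrite scale0r add0r.
exact: (is_derive_compf (g := fun h => sqn (h *: w + x)) D2 D1).
Qed.

Lemma differentiable_sqn x : differentiable sqn x.
Proof.
rewrite (_ : sqn = \sum_(i < n.+1) (fun y : V => y 0 i ^+ 2)).
  apply: differentiable_sum => i.
  exact: (@differentiableX _ _ (fun y : V => y 0 i : R) 1 x (differentiable_coord x 0 i)).
by apply/funext => y; rewrite fct_sumE.
Qed.

Lemma continuous_sqn : continuous sqn.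
Proof. by move=> x; exact: differentiable_continuous (differentiable_sqn x). Qed.

Lemma near_sqn x (u v : R) : sqn x \in `]u, v[ -> \forall y \near x, sqn y \in `]u, v[.
Proof.
move=> xI; have := @continuous_sqn x [set s | s \in `]u, v[].
by apply; exact: near_in_itvoo.
Qed.

Lemma near_derive U U' x w : (\forall y \near x, U y = U' y) ->
  \forall y \near x, 'D_w U y = 'D_w U' y.
Proof.
move=> /nbhs_interior; apply: filterS => y UU'; exact: near_eq_derive.
Qed.

Lemma near_laplacian U U' x : (\forall y \near x, U y = U' y) ->
  laplacian U x = laplacian U' x.
Proof.
move=> UU'; apply: eq_bigr => i _; apply: near_eq_derive.
exact: near_derive.
Qed.

Lemma laplacian_cst (c : R) x : laplacian (fun=> c) x = 0.
Proof.
apply: big1 => i _; rewrite /partial.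
have -> : (fun y : V => 'D_(delta_mx 0 i) (fun=> c) y) = (fun=> 0 : R).
  by apply/funext => y; exact: derive_cst.
exact: derive_cst.
Qed.

Section interval.
Variables u v : R.

Lemma laplacian_radial f f1 f2 x :
  {in `]u, v[, forall s : R, is_derive s 1 f (f1 s)} ->
  {in `]u, v[, forall s : R, is_derive s 1 f1 (f2 s)} ->
  sqn x \in `]u, v[ ->
  laplacian (fun y => f (sqn y)) x =
    4 * (sqn x * f2 (sqn x) + n.+1%:R / 2 * f1 (sqn x)).
Proof.
move=> df df1 xI.
have pf i : partial i (partial i (fun y => f (sqn y))) x =
    2 * f1 (sqn x) + 4 * f2 (sqn x) * x 0 i ^+ 2.
  rewrite /partial (@near_eq_derive _ _ _ _ (fun y => f1 (sqn y) * (2 * y 0 i))); last first.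
    apply: filterS (near_sqn xI) => y yI.
    by have [_ ->] := is_derive_radial (delta_mx 0 i) (df _ yI); rewrite dot_delta.
  have D1 := is_derive_radial (delta_mx 0 i) (df1 _ xI).
  have D2 : is_derive x (delta_mx 0 i) (fun y : V => 2 * y 0 i) 2.
    have := is_deriveZ 2 (is_derive_coord x (delta_mx 0 i) i).
    by rewrite mxE !eqxx [2 *: _]mulr1.
  have [_ ->] := is_deriveM D1 D2; rewrite dot_delta.
  by rewrite [_ *: _ + _](_ : _ = f1 (sqn x) * 2 + 2 * x 0 i * (f2 (sqn x) * (2 * x 0 i)))//; ring.
rewrite /laplacian (eq_bigr _ (fun i _ => pf i)) big_split/=.
by rewrite -[X in _ + X]mulr_sumr sumr_const card_ord -mulr_natr -/(sqn x); field.
Qed.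

(** Partial derivatives of a radial function are no longer radial. This algebra, generated by radial
    functions and coordinates, contains them and is stable under all partials, which turns
    smoothness into an induction on the list of derivatives. *)
Inductive radial_poly : (V -> R) -> Prop :=
| radial_poly_rad f of smooth_itv u v f : radial_poly (fun x => f (sqn x))
| radial_poly_coord i : radial_poly (fun x => x 0 i)
| radial_poly_cst c : radial_poly (fun=> c)
| radial_poly_add U W of radial_poly U & radial_poly W :
    radial_poly (fun x => U x + W x)
| radial_poly_mul U W of radial_poly U & radial_poly W :
    radial_poly (fun x => U x * W x).

Lemma radial_poly_differentiable U x : radial_poly U -> sqn x \in `]u, v[ ->
  differentiable U x.
Proof.
move=> pU xI; elim: pU => [f Sf|i|c|U1 U2 _ H1 _ H2|U1 U2 _ H1 _ H2].
- apply: (@differentiable_comp _ _ _ _ sqn f); first exact: differentiable_sqn.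
  have [df _] := smooth_itv_derive Sf; have [Df _] := df _ xI.
  exact/derivable1_diffP.
- exact: differentiable_coord.
- exact: differentiable_cst.
- exact: (differentiableD H1 H2).
- exact: (differentiableM H1 H2).
Qed.

Lemma radial_poly_partial U i : radial_poly U -> exists2 W, radial_poly W &
  forall x, sqn x \in `]u, v[ -> is_derive x (delta_mx 0 i) U (W x).
Proof.
elim=> [f Sf|j|c|U1 U2 p1 [W1 q1 H1] p2 [W2 q2 H2]|U1 U2 p1 [W1 q1 H1] p2 [W2 q2 H2]].
- have [df Sf'] := smooth_itv_derive Sf.
  exists (fun x => f^`()%classic (sqn x) * (2 * x 0 i)).
    apply: radial_poly_mul; first exact: radial_poly_rad.
    by apply: radial_poly_mul; [exact: radial_poly_cst|exact: radial_poly_coord].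
  move=> x xI; have := is_derive_radial (delta_mx 0 i) (df _ xI).
  by rewrite dot_delta.
- exists (fun=> (delta_mx 0 i : V) 0 j); first exact: radial_poly_cst.
  by move=> x _; exact: is_derive_coord.
- exists (fun=> 0); first exact: radial_poly_cst.
  by move=> x _; exact: is_derive_cst.
- exists (fun x => W1 x + W2 x); first exact: radial_poly_add.
  by move=> x xI; exact: (is_deriveD (H1 x xI) (H2 x xI)).
- exists (fun x => U1 x * W2 x + U2 x * W1 x).
    by apply: radial_poly_add; exact: radial_poly_mul.
  by move=> x xI; exact: (is_deriveM (H1 x xI) (H2 x xI)).
Qed.

Lemma radial_poly_partials U s : radial_poly U -> exists2 W, radial_poly W &
  forall x, sqn x \in `]u, v[ -> partials s U x = W x.
Proof.
move=> pU; elim: s => [|i s [W pW UW]]; first by exists U.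
have [W' pW' WW'] := radial_poly_partial i pW; exists W' => // x xI.
have [_ <-] := WW' x xI; apply: near_eq_derive.
by apply: filterS (near_sqn xI); exact: UW.
Qed.

Lemma open_radial : open [set x : V | sqn x \in `]u, v[].
Proof. by rewrite openE => x /= xI; exact: near_sqn. Qed.

Lemma smooth_radial f : smooth_itv u v f ->
  smooth_on [set x | sqn x \in `]u, v[] (fun x : V => f (sqn x)).
Proof.
move=> Sf s x xI; have [W pW WE] := radial_poly_partials s (radial_poly_rad Sf).
have dW := radial_poly_differentiable pW xI.
have WEx : \forall y \near x, W y = partials s (fun x => f (sqn x)) y.
  by apply: filterS (near_sqn xI) => y yI; rewrite WE.
split.
  have cW : W y @[y --> x] --> partials s (fun x => f (sqn x)) x.
    by rewrite WE//; exact: differentiable_continuous.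
  exact: cvg_trans (near_eq_cvg (F := nbhs x) WEx) cW.
by move=> i; apply: (near_eq_derivable WEx); exact: diff_derivable.
Qed.

End interval.

(** * The boundary operators on radial functions *)

Section boundary.
Variables (u v : R) (f f1 f2 lap lap1 : R -> R).
Hypotheses (u0 : u < 0) (v1 : 1 < v).
Hypotheses (df : {in `]u, v[, forall s : R, is_derive s 1 f (f1 s)})
  (df1 : {in `]u, v[, forall s : R, is_derive s 1 f1 (f2 s)})
  (lapE : {in `]u, v[, forall s : R, s * f2 s + n.+1%:R / 2 * f1 s = lap s})
  (dlap : {in `]u, v[, forall s : R, is_derive s 1 lap (lap1 s)}).
Let U x := f (sqn x).

Let I1 : 1 \in `]u, v[. Proof. by rewrite in_itv/= v1 (lt_trans u0). Qed.

Lemma unit_sphere_sqn x : unit_sphere x -> sqn x = 1.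
Proof. by rewrite /unit_sphere/= sqnE => ->; rewrite expr1n. Qed.

Lemma radial_derivative_radial (h : R -> R) (dh : R) x :
  is_derive (sqn x) 1 h dh ->
  radial_derivative (fun y : V => h (sqn y)) x = 2 * enorm x * dh.
Proof.
move=> Dh; rewrite /radial_derivative.
have [_ ->] := is_derive_radial ((enorm x)^-1 *: x) Dh.
rewrite dotZr -[dot x x]/(\sum_i _) (eq_bigr _ (fun i _ => esym (expr2 (x 0 i)))).
rewrite -/(sqn x) sqnE; have [->|e0] := eqVneq (enorm x) 0; first by rewrite expr0n/=; ring.
by field.
Qed.

Lemma normalize_unit x : 0 < sqn x -> unit_sphere ((enorm x)^-1 *: x).
Proof.
move=> x0; rewrite /unit_sphere/= enormE sqnZ sqnE exprVn mulVf ?sqrtr1//.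
by rewrite expf_neq0// enormE gt_eqF// sqrtr_gt0.
Qed.

Lemma near_sqn_gt0 x : unit_sphere x -> \forall y \near x, 0 < sqn y.
Proof.
move=> /unit_sphere_sqn x1.
have : sqn x \in `]0, 2[ by rewrite x1 in_itv/= ltr01 ltr1n.
by move=> /near_sqn; apply: filterS => y; rewrite in_itv/= => /andP[].
Qed.

(** The extension constant along rays is then constant near [x]. Both U and its radial derivative
    qualify when U is radial, so every spherical term of the boundary operators drops out. *)
Lemma sphere_laplacian_cst (W : V -> R) (c : R) x :
  (forall y, unit_sphere y -> W y = c) -> unit_sphere x ->
  sphere_laplacian W x = 0.
Proof.
move=> Wc x1; rewrite /sphere_laplacian -[RHS](laplacian_cst c x).
apply: near_laplacian; apply: filterS (near_sqn_gt0 x1) => y /normalize_unit.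
exact: Wc.
Qed.

Lemma radial_derivative_sphere x : unit_sphere x ->
  radial_derivative U x = 2 * f1 1.
Proof.
move=> x1; have s1 := unit_sphere_sqn x1.
have D : is_derive (sqn x) 1 f (f1 1) by rewrite s1; exact: df.
by apply: (eq_trans (radial_derivative_radial D)); rewrite (x1 : enorm x = 1) mulr1.
Qed.

(** Off the sphere the first radial derivative is 2 sqrt(s) f'(s) in s = |x|^2; differentiating the
    square root produces the extra term in f'(1). *)
Lemma radial_derivative2_sphere x : unit_sphere x ->
  radial_derivative (radial_derivative U) x = 4 * f2 1 + 2 * f1 1.
Proof.
move=> x1; have s1 := unit_sphere_sqn x1.
pose h (s : R) := 2 * Num.sqrt s * f1 s.
have Dh : is_derive (sqn x) 1 h (f1 1 + 2 * f2 1).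
  rewrite s1; have D1 := is_derive_scalef 2 (is_derive1_sqrt (ltr01 : 0 < 1 :> R)).
  have D2 := is_derive_mulf D1 (df1 I1).
  apply: (is_derive_cast D2) => //.
  by rewrite sqrtr1; field.
rewrite /radial_derivative (@near_eq_derive _ _ _ _ (fun y => h (sqn y))).
  have := radial_derivative_radial Dh; rewrite /radial_derivative => ->.
  by rewrite (x1 : enorm x = 1); ring.
have xI : sqn x \in `]u, v[ by rewrite s1.
apply: filterS (near_sqn xI) => y yI.
by have := radial_derivative_radial (df yI); rewrite /radial_derivative => ->.
Qed.

Lemma laplacian_radial_lap x : sqn x \in `]u, v[ -> laplacian U x = 4 * lap (sqn x).
Proof. by move=> xI; rewrite (laplacian_radial df df1 xI) lapE. Qed.

Lemma radial_derivative_laplacian_sphere x : unit_sphere x ->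
  radial_derivative (laplacian U) x = 8 * lap1 1.
Proof.
move=> x1; have s1 := unit_sphere_sqn x1.
rewrite /radial_derivative (@near_eq_derive _ _ _ _ (fun y => 4 * lap (sqn y))).
  have D : is_derive (sqn x) 1 (fun s => 4 * lap s) (4 * lap1 1).
    by rewrite s1; exact: is_derive_scalef (dlap I1).
  have := radial_derivative_radial D; rewrite /radial_derivative => ->.
  by rewrite (x1 : enorm x = 1); ring.
have xI : sqn x \in `]u, v[ by rewrite s1.
by apply: filterS (near_sqn xI) => y; exact: laplacian_radial_lap.
Qed.

Lemma bilaplacian_radial lap2 x :
  {in `]u, v[, forall s : R, is_derive s 1 lap1 (lap2 s)} ->
  sqn x \in `]u, v[ ->
  laplacian (laplacian U) x =
    16 * (sqn x * lap2 (sqn x) + n.+1%:R / 2 * lap1 (sqn x)).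
Proof.
move=> dlap1 xI; rewrite (@near_laplacian _ (fun y => 4 * lap (sqn y))).
  rewrite (@laplacian_radial u v (fun s => 4 * lap s) (fun s => 4 * lap1 s)
    (fun s => 4 * lap2 s))//; first by ring.
  - by move=> s sI; exact: is_derive_scalef (dlap sI).
  - by move=> s sI; exact: is_derive_scalef (dlap1 s sI).
by apply: filterS (near_sqn xI) => y; exact: laplacian_radial_lap.
Qed.

Lemma B1_sphere x : unit_sphere x ->
  B1 U x = 2 * f1 1 + (n%:R - 3) / 2 * f 1.
Proof.
by move=> x1; rewrite /B1 radial_derivative_sphere// /U unit_sphere_sqn.
Qed.

Lemma B2_sphere x : unit_sphere x ->
  B2 U x = 4 * f2 1 + 2 * (n%:R - 1) * f1 1 + (n%:R - 3) * (n%:R - 1) / 2 * f 1.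
Proof.
move=> x1; rewrite /B2 radial_derivative_sphere// radial_derivative2_sphere//.
rewrite (@sphere_laplacian_cst U (f 1))//; last first.
  by move=> y /unit_sphere_sqn; rewrite /U => ->.
by rewrite /U (unit_sphere_sqn x1); ring.
Qed.

(** The f'(1) contributed by the second radial derivative, with weight -(n-3)/2, cancels the
    first-order term. B_3 is thus insensitive to the slope, once f(1), f''(1) and the normal
    derivative of the Laplacian are known. *)
Lemma B3_sphere x : unit_sphere x ->
  B3 U x = (n%:R ^+ 2 - 1) * (n%:R - 3) / 4 * f 1
           - 8 * lap1 1 - 2 * (n%:R - 3) * f2 1.
Proof.
move=> x1; rewrite /B3 radial_derivative_laplacian_sphere//.
rewrite radial_derivative_sphere// radial_derivative2_sphere//.
rewrite (@sphere_laplacian_cst U (f 1))//; last first.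
  by move=> y /unit_sphere_sqn; rewrite /U => ->.
rewrite (@sphere_laplacian_cst (radial_derivative U) (2 * f1 1))//; last first.
  by move=> y; exact: radial_derivative_sphere.
by rewrite /U (unit_sphere_sqn x1); field.
Qed.

End boundary.

End radial_calculus.

Section radial_solution.
Context {R : realType}.
Variable n : nat.
Hypothesis hn : (4 <= n)%N.
Local Notation nr := (n%:R : R).

Lemma nr_ge4 : 4 <= nr.
Proof. by rewrite (ler_nat R 4 n). Qed.

Lemma kappa_gt0 : 0 < kappa R n.
Proof.
have := nr_ge4 => h; rewrite /kappa divr_gt0//.
by rewrite !mulr_gt0//; lra.
Qed.

(** The bilaplacian is 16 times the square of the operator s f'' + m f', hence the division. *)
Definition ksrc : R := kappa R n / 16.
Definition src (f : R -> R) : R -> R := source ksrc (pstar R n) f.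
Definition B3const : R := (nr ^+ 2 - 1) * (nr - 3) / 4.

Lemma ksrc_ge0 : 0 <= ksrc.
Proof. by rewrite divr_ge0// ltW// kappa_gt0. Qed.

Lemma pstar_ge0 : 0 <= pstar R n.
Proof. by have := nr_ge4 => h; rewrite divr_ge0//; lra. Qed.

(** What B_3 loses with respect to [B3const * alpha]: for a solution with source [g], [Jop n g 1] is
    the derivative at 1 of s f'' + m f', and [Eop n g] is f''(1). *)
Definition defect (g : R -> R) : R := 8 * Jop n g 1 + 2 * (nr - 3) * Eop n g.

Lemma defect_le (g h : R -> R) : continuous g -> continuous h ->
  (forall s : R, 0 <= s <= 1 -> g s <= h s) -> defect g <= defect h.
Proof.
move=> cg ch gh; have h4 := nr_ge4; apply: lerD.
  by rewrite ler_wpM2l//; apply: (@Jop_le R n _ _ 0 1) => //; rewrite ler01 lexx.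
rewrite ler_wpM2l//; last exact: (@Eop_le R n 0 1).
by lra.
Qed.

Lemma defect_ge0 (g : R -> R) : continuous g ->
  (forall s : R, 0 <= s <= 1 -> 0 <= g s) -> 0 <= defect g.
Proof.
move=> cg g0; have h4 := nr_ge4; apply: addr_ge0.
  by rewrite mulr_ge0//; apply: (@Jop_ge0 R n _ 0 1) => //; rewrite ler01 lexx.
apply: mulr_ge0; last exact: (@Eop_ge0 R n 0 1).
by lra.
Qed.

Lemma exists_radial_solution (alpha b c : R) (v : R -> R) : 0 < alpha ->
  0 <= b -> 0 <= c -> continuous v -> (forall s, 0 < v s) ->
  (forall s : R, 0 <= s <= 1 ->
    Top n alpha (b + c * Eop n (src v)) (src v) s <= v s) ->
  exists (U : 'rV[R]_n.+1 -> R) (f : R -> R),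
    [/\ positive_smooth_radial U,
        continuous f /\ forall s, 0 < f s,
        forall s : R, 0 <= s <= 1 -> f s <= v s,
        forall x, unit_ball x ->
          laplacian (laplacian U) x = kappa R n * U x `^ pstar R n &
        forall x, unit_sphere x -> [/\ U x = alpha,
          B1 U x = (nr - 3) / 2 * alpha - 2 * (b + c * Eop n (src f)),
          B2 U x = 4 * Eop n (src f) - 2 * (nr - 1) * (b + c * Eop n (src f))
                   + (nr - 3) * (nr - 1) / 2 * alpha &
          B3 U x = B3const * alpha - defect (src f)]].
Proof.
move=> alpha0 b0 c0 cv v0 Tv.
have [f [d [d0 cf f0 fv fE]]] :=
  radial_existence ksrc_ge0 pstar_ge0 alpha0 b0 c0 cv v0 Tv.
pose B := b + c * Eop n (src f).
have u0 : - d < 0 by rewrite oppr_lt0.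
have v1 : 1 < 1 + d by rewrite ltrDl.
have df := solution_derive1 cf f0 fE.
have df1 := @solution_derive2 R n ksrc (pstar R n) B d f d0 cf f0.
have lapE := @solution_lap R n ksrc (pstar R n) B d f d0 cf f0.
have dlap := @lap0_derive R n ksrc (pstar R n) B f cf f0.
have [w2 [dw2 w2E]] := bilap_solution d0 cf f0 fE.
have [f11 f21] := @solution_boundary R n ksrc (pstar R n) B d f d0 cf f0.
have f1E : f 1 = alpha.
  rewrite fE; last by apply/andP; split; lra.
  by rewrite /Top Zop1 subrr mulr0 !addr0.
have ball_itv (x : 'rV[R]_n.+1) : closed_unit_ball x -> sqn x \in `](- d)%R, (1 + d)%R[.
  rewrite /closed_unit_ball/= in_itv/= => x1.
  rewrite (lt_le_trans u0) ?sqn_ge0//= sqnE (le_lt_trans _ v1)//.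
  by rewrite expr_le1// /enorm sqrtr_ge0.
exists (fun x => f (sqn x)), f; split => //.
- split=> [x _||x y _ _ xy]; [exact: f0| |by rewrite !sqnE xy].
  exists [set x | sqn x \in `](- d)%R, (1 + d)%R[]; split.
  + exact: open_radial.
  + by move=> x; exact: ball_itv.
  + apply: smooth_radial => j; exact: solution_Ck fE j.
- move=> x x1; have xI : sqn x \in `](- d)%R, (1 + d)%R[.
    by apply: ball_itv; rewrite /closed_unit_ball/= ltW.
  rewrite (bilaplacian_radial df df1 lapE (fun s _ => dlap s) dw2 xI) w2E//.
  by rewrite /source /ksrc mulrA (mulrC 16) divfK.
- move=> x x1; split; first by rewrite unit_sphere_sqn.
  + by rewrite (B1_sphere u0 v1 df x1) f11 f1E /B; ring.
  + by rewrite (B2_sphere u0 v1 df df1 x1) f11 f21 f1E /B /src; ring.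
  + rewrite (B3_sphere u0 v1 df df1 lapE (fun s _ => dlap s) x1) f21 f1E.
    by rewrite /defect /B3const /src; ring.
Qed.

End radial_solution.

(** * The two boundary value problems *)

Section bubble.
Context {R : realType}.
Variables (n : nat) (a l C : R).
Hypotheses (nE : n.+1%:R / 2 = a + 2) (l0 : 0 < l).
Implicit Types (s : R).

(* a = (n - 3) / 2, and l is the square of the scale of the bubble. *)
Definition bubble s : R := C * (l + s) `^ (- a).
Let f1 s : R := - a * C * (l + s) `^ (- a - 1).
Let f2 s : R := a * (a + 1) * C * (l + s) `^ (- a - 2).
Let w s : R := - a * C * (l + s) `^ (- a - 1)
  - a * (a + 1) * l * C * (l + s) `^ (- a - 2).
Let w1 s : R := a * (a + 1) * C * (l + s) `^ (- a - 2)
  + a * (a + 1) * (a + 2) * l * C * (l + s) `^ (- a - 3).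
Let w2 s : R := - a * (a + 1) * (a + 2) * C * (l + s) `^ (- a - 3)
  - a * (a + 1) * (a + 2) * (a + 3) * l * C * (l + s) `^ (- a - 4).

(** The square of s f'' + m f' applied to [bubble]. Writing s = (l + s) - l leaves a single power,
    and a + 4 = a p^*, so it is a multiple of the bubble to the power p^*. *)
Definition bubble_source s : R :=
  a * (a + 1) * (a + 2) * (a + 3) * l ^+ 2 * C * (l + s) `^ (- a - 4).

Local Notation I := (`](- l)%R, 2%R[).

Let pos s : s \in I -> 0 < l + s.
Proof. by rewrite in_itv/= => /andP[h _]; rewrite -ltrBlDl sub0r. Qed.

Let pos01 s : 0 <= s <= 1 -> 0 < l + s.
Proof. by move=> /andP[h _]; rewrite ltr_wpDr. Qed.

Let dpow (c q s : R) : s \in I ->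
  is_derive s 1 (fun t => c * (l + t) `^ q) (c * q * (l + s) `^ (q - 1)).
Proof.
move=> sI; have D1 : is_derive s 1 (fun t : R => l + t) 1.
  apply: (is_derive_cast (is_derive_addf (is_derive_cst l s 1) (is_derive_id s 1))) => //.
  by rewrite add0r.
have D2 := is_derive_compf (g := fun t : R => l + t) (is_derive1_powR q (pos sI)) D1.
apply: (is_derive_cast (is_derive_scalef c D2)) => //.
by rewrite mulr1 mulrA.
Qed.

Let df : {in I, forall s : R, is_derive s 1 bubble (f1 s)}.
Proof.
move=> s sI; apply: (is_derive_cast (dpow C (- a) sI)) => //.
by rewrite /f1; ring.
Qed.

Let df1 : {in I, forall s : R, is_derive s 1 f1 (f2 s)}.
Proof.
move=> s sI; apply: (is_derive_cast (dpow (- a * C) (- a - 1) sI)) => //.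
by rewrite /f2 (_ : - a - 1 - 1 = - a - 2); ring.
Qed.

Let dw : {in I, forall s : R, is_derive s 1 w (w1 s)}.
Proof.
move=> s sI; apply: (is_derive_cast (is_derive_subf (dpow (- a * C) (- a - 1) sI)
  (dpow (a * (a + 1) * l * C) (- a - 2) sI))) => //.
rewrite /w1 (_ : - a - 1 - 1 = - a - 2); last by ring.
by rewrite (_ : - a - 2 - 1 = - a - 3); ring.
Qed.

Let dw1 : {in I, forall s : R, is_derive s 1 w1 (w2 s)}.
Proof.
move=> s sI; apply: (is_derive_cast (is_derive_addf (dpow (a * (a + 1) * C) (- a - 2) sI)
  (dpow (a * (a + 1) * (a + 2) * l * C) (- a - 3) sI))) => //.
rewrite /w2 (_ : - a - 2 - 1 = - a - 3); last by ring.
by rewrite (_ : - a - 3 - 1 = - a - 4); ring.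
Qed.

Let cpow (c q s : R) : s \in I -> {for s, continuous (fun t => c * (l + t) `^ q)}.
Proof. by move=> sI; exact: is_derive_continuous (dpow c q sI). Qed.

Let cf2 : {in I, forall s : R, {for s, continuous f2}}.
Proof. by move=> s; exact: cpow. Qed.

Let cw2 : {in I, forall s : R, {for s, continuous w2}}.
Proof. by move=> s sI; apply: cvgB; exact: cpow. Qed.

Let powS (q s : R) : 0 < l + s -> (l + s) `^ (q + 1) = (l + s) * (l + s) `^ q.
Proof.
move=> h; rewrite powRD; last by apply/implyP => _; rewrite gt_eqF.
by rewrite powRr1 ?ltW// mulrC.
Qed.

Let wE s : 0 <= s <= 1 -> w s = s * f2 s + n.+1%:R / 2 * f1 s.
Proof.
move=> /pos01 h; rewrite nE /w /f1 /f2.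
rewrite (_ : - a - 1 = - a - 2 + 1); last by ring.
by rewrite powS//; ring.
Qed.

Let gE s : 0 <= s <= 1 -> bubble_source s = s * w2 s + n.+1%:R / 2 * w1 s.
Proof.
move=> /pos01 h; rewrite nE /w1 /w2 /bubble_source.
rewrite (_ : - a - 2 = - a - 4 + 1 + 1); last by ring.
rewrite (_ : - a - 3 = - a - 4 + 1); last by ring.
by rewrite !powS//; ring.
Qed.

Variable alpha : R.
Hypothesis CE : C = alpha * (l + 1) `^ a.

Let pow1 (j : nat) : C * (l + 1) `^ (- a - j%:R) = alpha / (l + 1) ^+ j.
Proof.
have h : 0 < l + 1 by rewrite ltr_wpDr// ltW.
rewrite CE -mulrA -powRD; last by apply/implyP => _; rewrite gt_eqF.
rewrite addrA subrr sub0r powRN powR_mulrn//.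
by rewrite ltW.
Qed.

Let I1 : 0 <= (1 : R) <= 1. Proof. by rewrite ler01 lexx. Qed.
Let lm0 : - l < 0. Proof. by rewrite oppr_lt0. Qed.
Let lt12 : 1 < 2 :> R. Proof. by rewrite ltr1n. Qed.

Lemma bubble1 : bubble 1 = alpha.
Proof.
by have := pow1 0; rewrite subr0 expr0 divr1.
Qed.

(** Stated for any [g] agreeing with [bubble_source] on [0, 1], because [bubble_source] is singular
    at s = -l whereas the linearity lemmas need sources continuous on the whole line. *)
Lemma Zop_bubble g s : (forall x : R, 0 <= x <= 1 -> g x = bubble_source x) ->
  0 <= s <= 1 -> Zop n g s = bubble s - alpha + a * alpha / (l + 1) * (s - 1).
Proof.
move=> gb s01.
rewrite (eq_Zop n (fun x x01 => etrans (gb x x01) (gE x01)) s01).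
rewrite (Zop_representation lm0 lt12 df df1 cf2 wE dw dw1 cw2 s01) bubble1.
by rewrite /f1 -mulrA (pow1 1) expr1; ring.
Qed.

Lemma Eop_bubble g : (forall x : R, 0 <= x <= 1 -> g x = bubble_source x) ->
  Eop n g = a * (a + 1) * alpha / (l + 1) ^+ 2.
Proof.
move=> gb; rewrite (eq_Eop n (fun x x01 => etrans (gb x x01) (gE x01))).
rewrite (Eop_representation lm0 lt12 df1 cf2 wE dw dw1 cw2).
by rewrite /f2 -mulrA (pow1 2); ring.
Qed.

Lemma Jop_bubble g : (forall x : R, 0 <= x <= 1 -> g x = bubble_source x) ->
  Jop n g 1 = a * (a + 1) * alpha / (l + 1) ^+ 2
    + a * (a + 1) * (a + 2) * l * alpha / (l + 1) ^+ 3.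
Proof.
move=> gb; rewrite (eq_Jop n I1 (fun x x01 => etrans (gb x x01) (gE x01))).
rewrite (Jop1_representation n lm0 lt12 dw1 cw2).
by rewrite /w1 -![_ * C * _]mulrA (pow1 2) (pow1 3); ring.
Qed.

End bubble.

(** * The problem with B_1 prescribed *)

Section dirichlet.
Context {R : realType}.
Variable n : nat.
Hypothesis hn : (4 <= n)%N.
Local Notation nr := (n%:R : R).

Let n4 : 4 <= nr. Proof. exact: nr_ge4. Qed.
Let x0 : 0 < nr - 3. Proof. by have := n4; lra. Qed.
Let xN0 : nr - 3 != 0. Proof. by rewrite gt_eqF. Qed.

Lemma powR_add (x r s : R) : 0 < x -> x `^ (r + s) = x `^ r * x `^ s.
Proof. by move=> h; rewrite powRD//; apply/implyP => _; rewrite gt_eqF. Qed.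

Lemma powR_pstar_bd1 (alpha : R) : 0 < alpha ->
  alpha `^ pstar_bd R n 1 = alpha * alpha `^ (2 / (nr - 3)).
Proof.
move=> h; rewrite -{2}(powRr1 (ltW h)) -powR_add//; congr (_ `^ _).
by rewrite /pstar_bd; field.
Qed.

Lemma powR_pstar_bd3 (alpha : R) : 0 < alpha ->
  alpha `^ (- (6 / (nr - 3))) = alpha * alpha `^ (- pstar_bd R n 3).
Proof.
move=> h; rewrite -{2}(powRr1 (ltW h)) -powR_add//; congr (_ `^ _).
by rewrite /pstar_bd; field.
Qed.

Lemma powR_cancel (alpha r : R) : 0 < alpha -> alpha `^ (- r) * alpha `^ r = 1.
Proof. by move=> h; rewrite -powR_add// addNr powRr0. Qed.

Lemma B1_solution (c1 alpha : R) : c1 <= 0 -> 0 < alpha ->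
  alpha < (1 + 4 * c1 ^+ 2 / (nr - 3) ^+ 2) `^ (- ((nr - 3) / 4)) ->
  exists (U : 'rV[R]_n.+1 -> R) (c3 : R),
    [/\ positive_smooth_radial U, solves_P 1 alpha c1 c3 U,
        B3const n * alpha `^ (- (6 / (nr - 3))) * Lbound n alpha c1 <= c3 &
        c3 <= B3const n * alpha `^ (- (6 / (nr - 3)))].
Proof.
move=> c1_le0 alpha0 alphalt.
pose beta := alpha `^ (2 / (nr - 3)).
have beta0 : 0 < beta by exact: powR_gt0.
have beta2 : alpha `^ (4 / (nr - 3)) = beta ^+ 2.
  rewrite /beta -powR_mulrn ?powR_ge0// -powRrM; congr (_ `^ _); field; exact: xN0.
have beta4 : alpha `^ (8 / (nr - 3)) = beta ^+ 4.
  rewrite /beta -powR_mulrn ?powR_ge0// -powRrM; congr (_ `^ _); field; exact: xN0.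
pose eps := - (2 * c1 * beta / (nr - 3)).
have eps0 : 0 <= eps.
  rewrite oppr_ge0; apply: mulr_le0_ge0; last by rewrite invr_ge0 ltW.
  apply: mulr_le0_ge0; last exact: ltW.
  exact: mulr_ge0_le0.
pose T := 4 * c1 ^+ 2 / (nr - 3) ^+ 2.
have T0 : 0 <= T by rewrite divr_ge0 ?sqr_ge0// mulr_ge0 ?sqr_ge0.
have epsT : eps ^+ 2 = T * beta ^+ 2 by rewrite /eps /T; field; exact: xN0.
(* The hypothesis on alpha raised to the power 4/(n-3). Since eps^2 = T beta^2, it says beta^2 < 1 -
   eps^2. *)
have betaT : beta ^+ 2 < (1 + T)^-1.
  rewrite -beta2 -[(1 + T)^-1]powR_inv1 ?addr_ge0//.
  have r0 : 0 < 4 / (nr - 3) by rewrite divr_gt0.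
  have h1 : alpha \in Num.nneg by rewrite nnegrE ltW.
  have h2 : (1 + T) `^ (- ((nr - 3) / 4)) \in Num.nneg by rewrite nnegrE powR_ge0.
  have := gt0_ltr_powR r0 h1 h2 alphalt; rewrite -powRrM.
  by rewrite (_ : - ((nr - 3) / 4) * (4 / (nr - 3)) = -1)//; field; exact: xN0.
have T1 : 0 < 1 + T by rewrite ltr_wpDr.
have betaE : beta ^+ 2 < 1 - eps ^+ 2.
  by move: betaT; rewrite -[ltRHS]mul1r ltr_pdivlMr// epsT; lra.
have beta20 : 0 < beta ^+ 2 by rewrite exprn_gt0.
have eps1 : eps < 1.
  rewrite ltNge; apply/negP => h.
  have : 1 <= eps ^+ 2 by rewrite exprn_ege1.
  by lra.
have q0 : 0 < 1 - eps ^+ 2 by lra.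
have e1 : 0 < 1 + eps by lra.
have e2 : 0 < 1 - eps by lra.
pose a := (nr - 3) / 2.
have a0 : 0 < a by rewrite divr_gt0.
have nE : n.+1%:R / 2 = a + 2 :> R by rewrite -natr1 /a; field.
(* A bubble with value alpha at 1 has B_1 = a alpha (l - 1)/(l + 1); equating this with -a alpha eps
   gives [l], positive because eps < 1. *)
pose l := (1 - eps) / (1 + eps).
have l0 : 0 < l by rewrite divr_gt0.
have lE : l + 1 = 2 / (1 + eps) by rewrite /l; field; rewrite gt_eqF.
have l10 : 0 < l + 1 by rewrite lE divr_gt0.
pose C := alpha * (l + 1) `^ a.
have C0 : 0 < C by rewrite mulr_gt0// powR_gt0.
pose v s := bubble a l C (clamp 0 1 s).
have cl01 (s : R) : 0 <= clamp 0 1 s <= 1 by exact: clamp_itv.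
have lcl (s : R) : 0 < l + clamp 0 1 s by case/andP: (cl01 s) => h _; rewrite ltr_wpDr.
have v0 s : 0 < v s by rewrite mulr_gt0// powR_gt0.
have cv : continuous v.
  move=> s; rewrite /v /bubble; apply: cvgM; first exact: cvg_cst.
  apply: (@continuous_comp _ _ _ (fun s : R => l + clamp 0 1 s) (fun y : R => y `^ (- a))).
    apply: cvgD; first exact: cvg_cst.
    exact: lipschitz_continuous (clamp_lipschitz ler01) s.
  exact: powR_continuous.
(* The ratio of the source at v to D^2 v; theta <= 1 is the bound on alpha. *)
pose theta := beta ^+ 4 / (1 - eps ^+ 2) ^+ 2.
have theta0 : 0 < theta by rewrite divr_gt0 ?exprn_gt0.
have theta1 : theta <= 1.
  rewrite ler_pdivrMr ?exprn_gt0// mul1r (_ : beta ^+ 4 = (beta ^+ 2) ^+ 2); last by ring.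
  by rewrite ler_sqr ?nnegrE ltW.
have srcE (s : R) : 0 <= s <= 1 -> src n v s = theta * bubble_source a l C s.
  move=> s01; rewrite /src /source /v clamp_id// /bubble /bubble_source.
  have h : 0 < l + s by case/andP: s01 => h _; rewrite ltr_wpDr.
  rewrite powRM ?powR_ge0 ?(ltW C0)// -powRrM.
  rewrite (_ : - a * pstar R n = - a - 4); last by rewrite /a /pstar; field.
  rewrite (_ : pstar R n = 1 + 8 / (nr - 3)); last by rewrite /pstar; field.
  rewrite powR_add// powRr1 ?(ltW C0)// {2}/C powRM ?powR_ge0 ?(ltW alpha0)//.
  rewrite beta4 -powRrM (_ : a * (8 / (nr - 3)) = 4%:R); last by rewrite /a; field.
  rewrite powR_mulrn ?(ltW l10)// lE /theta /l /ksrc /kappa /a.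
  by field; rewrite !gt_eqF.
have csrc : continuous (src n v) by exact: continuous_source.
(* A globally continuous stand-in for [bubble_source], equal to it on [0, 1]. *)
pose g (s : R) := theta^-1 * src n v s.
have gE (s : R) : 0 <= s <= 1 -> g s = bubble_source a l C s.
  by move=> s01; rewrite /g srcE// mulKf// gt_eqF.
have cg : continuous g by move=> s; apply: cvgM; [exact: cvg_cst|exact: csrc].
pose b := a * alpha / (l + 1).
have b0 : 0 <= b by rewrite divr_ge0 ?mulr_ge0 ?ltW.
have ZE (s : R) : 0 <= s <= 1 ->
    Zop n (src n v) s = theta * (bubble a l C s - alpha + b * (s - 1)).
  move=> s01; rewrite -(Zop_bubble nE l0 (erefl C) gE s01).
  rewrite /g (@Zop_scale R n theta^-1 (src n v) s csrc).
  by rewrite mulVKf// gt_eqF.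
have Tv (s : R) : 0 <= s <= 1 ->
    Top n alpha (b + 0 * Eop n (src n v)) (src n v) s <= v s.
  move=> s01; rewrite /Top mul0r addr0 ZE// /v clamp_id//.
  pose Z := bubble a l C s - alpha + b * (s - 1).
  have Z0 : 0 <= Z.
    rewrite /Z -(Zop_bubble nE l0 (erefl C) gE s01).
    apply: (@Zop_ge0 R n 0 1) => // y y01.
    by rewrite /g mulr_ge0 ?invr_ge0 ?(ltW theta0)// source_ge0// ksrc_ge0.
  (* The bubble is its first-order Taylor polynomial at 1 plus [Z], while the operator returns that
     polynomial plus [theta * Z]; as [Z >= 0] and [theta <= 1], it is a supersolution. *)
  rewrite -/Z [leRHS](_ : _ = alpha + b * (1 - s) + 1 * Z); last by rewrite /Z; ring.
  by rewrite lerD2l ler_wpM2r.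
have [U [f [psU [cf f0] fv eqU bU]]] :=
  exists_radial_solution hn alpha0 b0 (lexx 0) cv v0 Tv.
have csf : continuous (src n f) by exact: continuous_source.
pose p3 := pstar_bd R n 3.
pose S := defect n (src n f).
have pi0 : 0 < alpha `^ (- p3) by exact: powR_gt0.
exists U, ((B3const n * alpha - S) * alpha `^ (- p3)); split => //.
- split=> // x /bU[Ux B1x _ B3x]; split=> //=.
    rewrite B1x mul0r addr0 powR_pstar_bd1// -/beta /b lE /a /eps.
    field; rewrite xN0 /=.
    rewrite -/eps (_ : nr - 3 - 2 * c1 * beta = (nr - 3) * (1 + eps)).
      by rewrite mulf_neq0// gt_eqF.
    by rewrite /eps; field.
  by rewrite B3x -mulrA powR_cancel// mulr1.
- rewrite powR_pstar_bd3// -/p3.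
  have dv : defect n (src n v)
      = theta * (B3const n * alpha * (1 + eps / 2 * (3 - eps ^+ 2))).
    have EE := Eop_bubble nE l0 (erefl C) gE.
    have JE := Jop_bubble nE l0 (erefl C) gE.
    rewrite /g (@Eop_scale R n theta^-1 (src n v) csrc) in EE.
    rewrite /g (@Jop_scale R n theta^-1 (src n v) 1 csrc) in JE.
    have EE' : Eop n (src n v) = theta * (a * (a + 1) * alpha / (l + 1) ^+ 2).
      by rewrite -EE mulVKf// gt_eqF.
    have JE' : Jop n (src n v) 1 = theta * (a * (a + 1) * alpha / (l + 1) ^+ 2
       + a * (a + 1) * (a + 2) * l * alpha / (l + 1) ^+ 3).
      by rewrite -JE mulVKf// gt_eqF.
    rewrite /defect EE' JE' lE /l /B3const /a; field.
    by rewrite gt_eqF.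
  have Sle : S <= defect n (src n v).
    apply: defect_le => // s s01; apply: source_le; rewrite ?pstar_ge0 ?ksrc_ge0 ?(ltW (f0 _))//.
    exact: fv.
  have LE : Lbound n alpha c1 = 1 - theta * (1 + eps / 2 * (3 - eps ^+ 2)).
    rewrite /Lbound beta2 beta4 -/beta /= (_ : 4 * c1 ^+ 2 * _ / _ = eps ^+ 2); last first.
      by rewrite epsT /T; field.
    rewrite (_ : c1 * beta / (nr - 3) = - (eps / 2)); last by rewrite /eps; field.
    by rewrite /theta; field; rewrite gt_eqF.
  rewrite LE [leLHS](_ : _ = (B3const n * alpha - defect n (src n v)) * alpha `^ (- p3)).
    by rewrite ler_wpM2r ?(ltW pi0)// lerB.
  by rewrite dv; ring.
- rewrite powR_pstar_bd3// -/p3 mulrA ler_wpM2r ?(ltW pi0)//.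
  rewrite gerBl; apply: defect_ge0 => // s _.
  by apply: source_ge0; exact: ksrc_ge0.
Qed.

End dirichlet.

(** * The problem with B_2 prescribed *)

Section second_order.
Context {R : realType}.
Variable n : nat.
Hypothesis hn : (4 <= n)%N.
Local Notation nr := (n%:R : R).

Let n4 : 4 <= nr. Proof. exact: nr_ge4. Qed.
Let x0 : 0 < nr - 3. Proof. by have := n4; lra. Qed.
Let xN0 : nr - 3 != 0. Proof. by rewrite gt_eqF. Qed.
Let y0 : 0 < nr - 1. Proof. by have := n4; lra. Qed.

Lemma powR_pstar_bd2 (alpha : R) : 0 < alpha -> alpha <= 1 ->
  alpha `^ pstar_bd R n 2 <= alpha.
Proof.
move=> h0 h1; apply: ge1r_powR; first by rewrite h0.
by rewrite /pstar_bd ler_pdivlMr// mul1r; lra.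
Qed.

Lemma B2_solution (c2 : R) : c2 <= 0 -> exists2 alpha0 : R, 0 < alpha0 &
  exists M : R, forall alpha, 0 < alpha -> alpha < alpha0 ->
  exists (U : 'rV[R]_n.+1 -> R) (c3 : R),
    [/\ positive_smooth_radial U, solves_P 2 alpha c2 c3 U &
        `|c3 - B3const n * alpha `^ (1 - pstar_bd R n 3)|
          <= M * alpha `^ (pstar R n - pstar_bd R n 3)].
Proof.
move=> c2_le0; pose p := pstar R n; pose k : R := ksrc n.
have k0 : 0 <= k by exact: ksrc_ge0.
have p0 : 0 <= p by exact: pstar_ge0.
pose one : R -> R := fun=> 1.
have c_one : continuous one by move=> ?; exact: cvg_cst.
have one0 x : 0 <= one x by exact: ler01.
pose c := 2 / (nr - 1).
have c0 : 0 <= c by rewrite divr_ge0 ?ltW.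
(* Since p_2^* >= 1, alpha <= 1 and c_2 <= 0, the data satisfy [alpha + b <= H1 * alpha]. The
   constant supersolution [2 * H1 * alpha] leaves an equal share for the nonlinear part. *)
pose H1 := 1 + ((nr - 3) / 4 - c2 / (2 * (nr - 1))).
have dc2 : c2 / (2 * (nr - 1)) <= 0.
  by rewrite mulr_le0_ge0 ?invr_ge0 ?mulr_ge0// ltW.
have d30 : 0 <= (nr - 3) / 4 by rewrite divr_ge0 ?ltW.
have H10 : 0 < H1 by rewrite /H1; lra.
have E0 : 0 <= Eop n one by apply: (@Eop_ge0 R n 0 1) => // x _; exact: one0.
have Z0 : 0 <= Zop n one 0.
  by apply: (@Zop_ge0 R n 0 1) => //; rewrite lexx ler01.
(* Bounds what a unit power contributes on [0, 1] through the slope and through [Zop], the latter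
   being largest at s = 0. *)
pose D := k * (c * Eop n one + Zop n one 0).
have D0 : 0 <= D by rewrite mulr_ge0// addr_ge0// mulr_ge0.
pose q := 8 / (nr - 3).
have q0 : 0 < q by rewrite divr_gt0.
have pE : p = 1 + q by rewrite /p /q /pstar; field.
(* Chosen so that [D * W <= 1 / 2]; [alpha0] then ensures (H alpha)^q <= W, where q = p^* - 1. *)
pose W := (2 * D + 1)^-1.
have W0 : 0 < W by rewrite invr_gt0; lra.
pose H := 2 * H1.
have H0 : 0 < H by rewrite mulr_gt0.
pose alpha0 := Num.min 1 (W `^ q^-1 / H).
have alpha0_gt0 : 0 < alpha0 by rewrite lt_min ltr01 divr_gt0// powR_gt0.
exists alpha0 => //; exists (defect n one * k * H `^ p) => alpha al0.
rewrite lt_min => /andP[/ltW al1 al2].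
pose b := (nr - 3) / 4 * alpha - c2 * alpha `^ pstar_bd R n 2 / (2 * (nr - 1)).
have b_ge0 : 0 <= b.
  rewrite /b subr_ge0; apply: (@le_trans _ _ 0); last by rewrite mulr_ge0// ltW.
  rewrite mulr_le0_ge0 ?invr_ge0 ?mulr_ge0 ?(ltW y0)//.
  by rewrite mulr_le0_ge0 ?powR_ge0.
have b_le : alpha + b <= H1 * alpha.
  have := powR_pstar_bd2 al0 al1; rewrite /b /H1 => h.
  have : - (c2 / (2 * (nr - 1))) * alpha `^ pstar_bd R n 2
      <= - (c2 / (2 * (nr - 1))) * alpha by rewrite ler_wpM2l// oppr_ge0.
  by rewrite mulrAC; lra.
pose M := H * alpha.
have M0 : 0 < M by rewrite mulr_gt0.
have MW : M `^ q <= W.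
  have -> : W = (W `^ q^-1) `^ q by rewrite -powRrM mulVf ?gt_eqF// powRr1// ltW.
  rewrite ge0_ler_powR ?nnegrE ?powR_ge0 ?(ltW M0) ?(ltW q0)//.
  by rewrite /M mulrC -ler_pdivlMr// ltW.
pose A := k * M `^ p.
have A0 : 0 <= A by rewrite mulr_ge0// powR_ge0.
pose v : R -> R := fun=> M.
have cv : continuous v by move=> ?; exact: cvg_cst.
have srcE : src n v = fun x => A * one x by apply/funext => x; rewrite /one mulr1.
have DM : A * (c * Eop n one + Zop n one 0) <= H1 * alpha.
  have -> : A * (c * Eop n one + Zop n one 0) = D * M `^ q * M.
    by rewrite /A /D pE powR_add// powRr1 ?(ltW M0)//; ring.
  have : D * M `^ q <= 1 / 2.
    apply: (@le_trans _ _ (D * W)); first by rewrite ler_wpM2l.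
    by rewrite /W ler_pdivrMr; lra.
  move=> /(ler_wpM2r (ltW M0)) h; apply: (le_trans h).
  by rewrite /M /H le_eqVlt; apply/orP; left; apply/eqP; field.
have Tv (s : R) : 0 <= s <= 1 ->
    Top n alpha (b + c * Eop n (src n v)) (src n v) s <= v s.
  move=> s01; have /andP[s0 s1] := s01.
  rewrite srcE /Top (@Zop_scale R n A one s c_one) (@Eop_scale R n A one c_one).
  have h1 : (b + c * (A * Eop n one)) * (1 - s) <= (b + c * (A * Eop n one)) * 1.
    apply: ler_wpM2l; last by rewrite gerBl.
    by apply: addr_ge0 => //; do 2 apply: mulr_ge0 => //.
  have h2 : A * Zop n one s <= A * Zop n one 0.
    by rewrite ler_wpM2l// Zop_ninc.
  have : v s = H1 * alpha + H1 * alpha by rewrite /v /M /H; ring.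
  have : A * (c * Eop n one + Zop n one 0) = c * (A * Eop n one) + A * Zop n one 0 by ring.
  by move=> hA ->; rewrite hA in DM; lra.
have [U [f [psU [cf f0] fv eqU bU]]] :=
  exists_radial_solution hn al0 b_ge0 c0 cv (fun=> M0) Tv.
have csf : continuous (src n f) by exact: continuous_source.
pose p3 := pstar_bd R n 3.
pose S := defect n (src n f).
exists U, ((B3const n * alpha - S) * alpha `^ (- p3)); split => //.
- split=> // x /bU[Ux _ B2x B3x]; split=> //=; last first.
    by rewrite B3x -mulrA powR_cancel// mulr1.
  by rewrite B2x /b /c; field; rewrite gt_eqF.
- have S0 : 0 <= S.
    by apply: defect_ge0 => // s _; apply: source_ge0; exact: ksrc_ge0.
  have SM : S <= defect n one * k * H `^ p * alpha `^ p.
    have -> : defect n one * k * H `^ p * alpha `^ p = defect n (src n v).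
      rewrite srcE /defect (@Jop_scale R _ A one 1 c_one) (@Eop_scale R n A one c_one).
      by rewrite /A /M powRM ?ltW//; ring.
    apply: defect_le => //.
      by rewrite srcE => x; apply: cvgM; [exact: cvg_cst|exact: c_one].
    move=> s s01; apply: source_le; rewrite ?pstar_ge0 ?ksrc_ge0 ?(ltW (f0 _))//.
    exact: fv.
  have -> : alpha `^ (1 - pstar_bd R n 3) = alpha * alpha `^ (- p3).
    by rewrite powR_add// powRr1// ltW.
  have -> : alpha `^ (pstar R n - pstar_bd R n 3) = alpha `^ p * alpha `^ (- p3).
    by rewrite powR_add.
  rewrite (_ : _ - B3const n * _ = - (S * alpha `^ (- p3))); last by ring.
  rewrite normrN (ger0_norm (mulr_ge0 S0 (powR_ge0 _ _))) mulrA.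
  by rewrite ler_wpM2r// powR_ge0.
Qed.

End second_order.

Unset Implicit Arguments.

Theorem theorem1p2 (R : realType) (n : nat) (hn : (4 <= n)%N) :
  (forall c1 alpha : R, c1 <= 0 -> 0 < alpha ->
     alpha < (1 + 4 * c1 ^+ 2 / (n%:R - 3) ^+ 2) `^ (- ((n%:R - 3) / 4)) ->
     exists (U : 'rV[R]_n.+1 -> R) (c3 : R),
       [/\ positive_smooth_radial U,
           solves_P 1 alpha c1 c3 U,
           (n%:R ^+ 2 - 1) * (n%:R - 3) / 4 * alpha `^ (- (6 / (n%:R - 3)))
             * Lbound n alpha c1 <= c3 &
           c3 <= (n%:R ^+ 2 - 1) * (n%:R - 3) / 4
                   * alpha `^ (- (6 / (n%:R - 3)))]) /\
  (forall c2 : R, c2 <= 0 ->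
     exists (alpha0 : R) (U : R -> 'rV[R]_n.+1 -> R) (c3 : R -> R),
       [/\ 0 < alpha0,
           forall alpha : R, 0 < alpha -> alpha < alpha0 ->
             positive_smooth_radial (U alpha) /\
             solves_P 2 alpha c2 (c3 alpha) (U alpha) &
           (fun alpha : R => c3 alpha - (n%:R ^+ 2 - 1) * (n%:R - 3) / 4
                               * alpha `^ (1 - pstar_bd R n 3))
             =O_ (0^'+)
           (fun alpha : R => alpha `^ (pstar R n - pstar_bd R n 3))]).
Proof.
split=> [c1 alpha|c2 c2_le0]; first exact: B1_solution.
have [alpha0 alpha0_gt0 [M HM]] := B2_solution hn c2_le0.
(* The pair (U, c_3) is chosen as a function of alpha on the whole line, with the value 0 outside
   the range. *)
have /choice[F FE] (alpha : R) : exists Uc : ('rV[R]_n.+1 -> R) * R,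
    0 < alpha -> alpha < alpha0 ->
    [/\ positive_smooth_radial Uc.1, solves_P 2 alpha c2 Uc.2 Uc.1 &
        `|Uc.2 - B3const n * alpha `^ (1 - pstar_bd R n 3)|
          <= M * alpha `^ (pstar R n - pstar_bd R n 3)].
  have [h|h] := pselect (0 < alpha /\ alpha < alpha0).
    by have [U [c3 HU]] := HM alpha h.1 h.2; exists (U, c3).
  by exists ((fun=> 0), 0) => h1 h2; case: h.
exists alpha0, (fun alpha => (F alpha).1), (fun alpha => (F alpha).2); split => //.
  by move=> alpha h1 h2; have [] := FE alpha h1 h2.
apply/eqO_exP; exists (`|M| + 1); first by rewrite ltr_wpDl.
near=> alpha.
have h1 : 0 < alpha by near: alpha; exact: nbhs_right_gt.
have h2 : alpha < alpha0 by near: alpha; exact: nbhs_right_lt.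
have [_ _ /le_trans] := FE alpha h1 h2; apply.
rewrite (ger0_norm (powR_ge0 _ _)) ler_wpM2r ?powR_ge0//.
by rewrite (le_trans (ler_norm M))// lerDl.
Unshelve. all: by end_near. Qed.
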